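(* Let $X$ be a Banach space over $\mathbb{K}$ whose norm is micro-transitive and whose second numerical index satisfies $n'(X)>0$. Then $X$ has the Bishop–Phelps–Bollobás point property for numerical radius (BPBpp-nu).
   Context: Let $X$ be a Banach space over $\mathbb{K}\in\{\mathbb{R},\mathbb{C}\}$, with unit sphere $S_X$, dual $X^*$, and let $\mathcal{L}(X)$ denote the space of bounded linear operators on $X$ with the operator norm $\|T\|=\sup_{x\in S_X}\|Tx\|$. The set of states is $\Pi(X)=\{(x,x^* )\in S_X\times S_{X^*}: x^*(x)=1\}$. The numerical radius of $T\in\mathcal{L}(X)$ is $v(T)=\sup\{|x^*(Tx)|:(x,x^* )\in\Pi(X)\}$. Let $\mathcal{Z}(X)=\{T\in\mathcal{L}(X): v(T)=0\}$ and $\|T+\mathcal{Z}(X)\|=\inf\{\|T-G\|: G\in\mathcal{Z}(X)\}$. The second numerical index is $n'(X)=\inf\{v(T)/\|T+\mathcal{Z}(X)\| : T\in\mathcal{L}(X)\setminus\mathcal{Z}(X)\}$. The norm of $X$ is micro-transitive if, letting $G$ be the group of surjective linear isometries of $X$ (with the topology induced by the operator norm), for every $x\in S_X$ and every neighborhood $U$ of the identity in $G$, the set $\{g(x): g\in U\}$ is a neighborhood of $x$ in $S_X$. $X$ has the BPBpp-nu if for every $\varepsilon>0$ there is $\eta(\varepsilon)>0$ such that whenever $T\in\mathcal{L}(X)$ with $v(T)=1$ and $(x,x^* )\in\Pi(X)$ satisfy $|x^*(Tx)|>1-\eta(\varepsilon)$, there exists $S\in\mathcal{L}(X)$ with $v(S)=1$,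 $|x^*(Sx)|=1$ and $\|S-T\|<\varepsilon$. *)

(* Defs.v *)
From HB Require Import structures.
From mathcomp Require Import all_boot all_order all_algebra.
From mathcomp Require Import all_classical all_reals.
From mathcomp Require Import ereal topology normedtype.
From mathcomp Require Import complex.
Set Implicit Arguments. Unset Strict Implicit. Unset Printing Implicit Defensive.
Import Order.TTheory GRing.Theory Num.Theory.
Local Open Scope ring_scope.
Local Open Scope classical_set_scope.

Inductive scalar_kind := RealScalars | ComplexScalars.

Definition scalars (R : realType) (k : scalar_kind) : numFieldType :=
  match k with
  | RealScalars => R
  | ComplexScalars => (R[i])%C
  end.

(* The (real) value of a real element of K: identity for R, real part for C.
   It is only applied to norms / absolute values, which are real. *)
Definition to_real (R : realType) (k : scalar_kind) : scalars R k -> R :=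
  match k return scalars R k -> R with
  | RealScalars => fun a => a
  | ComplexScalars => fun z => complex.Re z
  end.

Section BanachDefs.
Variables (R : realType) (k : scalar_kind) (X : normedModType (scalars R k)).
Local Notation K := (scalars R k).

Definition sabs (a : K) : R := to_real (`|a|).
Definition nrm (x : X) : R := to_real (`|x|).

Definition unit_sphere : set X := [set x | nrm x = 1].

Definition is_linear_op (T : X -> X) :=
  forall (a : K) (x y : X), T (a *: x + y) = a *: T x + T y.
Definition is_bounded_op (T : X -> X) :=
  exists M : R, forall x, nrm (T x) <= M * nrm x.
Definition bounded_operator (T : X -> X) := is_linear_op T /\ is_bounded_op T.

Definition op_norm (T : X -> X) : R := sup [set nrm (T x) | x in unit_sphere].

Definition is_linear_functional (f : X -> K) :=
  forall (a : K) (x y : X), f (a *: x + y) = a * f x + f y.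
Definition is_bounded_functional (f : X -> K) :=
  exists M : R, forall x, sabs (f x) <= M * nrm x.
Definition dual_elt (f : X -> K) := is_linear_functional f /\ is_bounded_functional f.
Definition dual_norm (f : X -> K) : R := sup [set sabs (f x) | x in unit_sphere].

Definition states : set (X * (X -> K)) :=
  [set p | unit_sphere p.1 /\ dual_elt p.2 /\ dual_norm p.2 = 1 /\ p.2 p.1 = 1].

Definition numerical_radius (T : X -> X) : R :=
  sup [set sabs (p.2 (T p.1)) | p in states].

Definition Zset : set (X -> X) :=
  [set G | bounded_operator G /\ numerical_radius G = 0].

Definition quot_norm (T : X -> X) : R :=
  inf [set op_norm (fun x => T x - G x) | G in Zset].

(* second numerical index n'(X) (extended real; inf of the empty set is +oo) *)
Definition second_numerical_index : \bar R :=
  ereal_inf [set ((numerical_radius T) / quot_norm T)%:E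
            | T in [set T | bounded_operator T /\ ~ Zset T]].

Definition surj_isometry (g : X -> X) :=
  is_linear_op g /\ (forall x, nrm (g x) = nrm x) /\ (forall y, exists x, g x = y).

(* micro-transitivity: for x in S_X and every neighbourhood U of Id in G
   (operator-norm topology, i.e. U contains {g in G : ||g - Id|| < delta}),
   {g x : g in U} is a neighbourhood of x in S_X (i.e. contains
   {y in S_X : ||y - x|| < eps}). *)
Definition micro_transitive :=
  forall x, unit_sphere x ->
  forall U : set (X -> X),
    (exists2 delta : R, 0 < delta &
       forall g, surj_isometry g -> op_norm (fun z => g z - z) < delta -> U g) ->
    exists2 eps : R, 0 < eps &
      forall y, unit_sphere y -> nrm (y - x) < eps ->
        exists g, [/\ surj_isometry g, U g & g x = y].

Definition BPBpp_nu :=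
  forall eps : R, 0 < eps -> exists2 eta : R, 0 < eta &
    forall T, bounded_operator T -> numerical_radius T = 1 ->
    forall p, states p -> sabs (p.2 (T p.1)) > 1 - eta ->
      exists S, [/\ bounded_operator S, numerical_radius S = 1,
                    sabs (p.2 (S p.1)) = 1 &
                    op_norm (fun z => S z - T z) < eps].

End BanachDefs.

(* Main.v *)
(** The isometry group acts transitively on the sphere, since orbits contain
    uniform neighbourhoods of their points, and therefore micro-transitively with
    uniform constants. The convex function s |-> |x + s y| has almost no corner at
    some small s; an isometry close to the identity moves that point to x, so the
    norm is uniformly smooth. Consequently functionals that nearly attain their
    norm at the same point are close to each other, i.e. the dual norm is uniformly
    convex.

    The norm is also uniformly convex. Otherwise, by transitivity, thin slices of
    the ball at every point of the sphere have almost the same diameter D > 0, and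
    each of their points is almost at distance D from another one. Picking each
    new point far from the mean of the previous ones yields x_0, x_1, ... at mutual
    distances about D, with functionals f_j such that f_j (x_i - x_j) is about D
    for i < j. Smoothness forces f_j (x_0 - x_m) >= c D for j < m, so the f_j are
    separated on successive blocks; uniform convexity of the dual makes their
    dyadic means tend to 0, while these means stay >= c D on x_0 - x_m.

    Finally let |f (T x)| be almost v(T) = 1 for a state (x, f), with T reduced
    modulo Z(X) to an operator of bounded norm. Adding a small multiple of
    f(.) x to T forces every state (y, h) that almost attains the new numerical
    radius to satisfy |f y| ~ 1, so y is close to x up to a phase and an isometry
    close to the identity moves (y, h) back to (x, f). Conjugating by it gives an
    operator close to T for which (x, f) almost attains the numerical radius with
    a much smaller error, and iterating converges to the required S. *)

Require Import Defs.
From HB Require Import structures.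
From mathcomp Require Import all_boot all_order all_algebra.
From mathcomp Require Import all_classical all_reals.
From mathcomp Require Import ereal topology normedtype.
From mathcomp Require Import complex ring lra zify.
Import Order.TTheory GRing.Theory Num.Theory.
Local Open Scope ring_scope.
Set Implicit Arguments. Unset Strict Implicit. Unset Printing Implicit Defensive.

(** * Uniform smoothness *)

Section RealSeminorm.
Variables (R : realType) (V : lmodType R) (N : V -> R).

Definition seminorm :=
  (forall x y, N (x + y) <= N x + N y) /\ (forall a x, N (a *: x) = `|a| * N x).

(** The real-linear members of the dual unit ball; a one-sided bound is enough because
    [F (- x) = - F x]. *)
Definition contraction (F : V -> R) :=
  (forall a x y, F (a *: x + y) = a * F x + F y) /\ (forall x, F x <= N x).

Definition lin_isometry (g : V -> V) :=
  (forall a x y, g (a *: x + y) = a *: g x + g y) /\ (forall x, N (g x) = N x).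

Hypothesis Nsemi : seminorm.

Lemma ND x y : N (x + y) <= N x + N y. Proof. exact: Nsemi.1. Qed.
Lemma NZ a x : N (a *: x) = `|a| * N x. Proof. exact: Nsemi.2. Qed.
Lemma NN x : N (- x) = N x.
Proof. by rewrite -scaleN1r NZ normrN1 mul1r. Qed.
Lemma N0 : N 0 = 0.
Proof. by rewrite -(scale0r 0) NZ normr0 mul0r. Qed.
Lemma N_ge0 x : 0 <= N x.
Proof. by have := ND x (- x); rewrite subrr N0 NN; lra. Qed.
Lemma NBC x y : N (x - y) = N (y - x).
Proof. by rewrite -NN opprB. Qed.
Lemma NB_trans y x z : N (x - z) <= N (x - y) + N (y - z).
Proof. by have := ND (x - y) (y - z); rewrite addrA subrK. Qed.
Lemma N_leB x y : N x <= N y + N (x - y).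
Proof. by have := ND y (x - y); rewrite addrC subrK. Qed.
Lemma N_normalize x : N x != 0 -> N ((N x)^-1 *: x) = 1.
Proof.
move=> x0; rewrite NZ ger0_norm ?mulVf// invr_ge0; exact: N_ge0.
Qed.
Lemma N_normalizeB x : N x != 0 -> N ((N x)^-1 *: x - x) = `|1 - N x|.
Proof.
move=> x0; have -> : (N x)^-1 *: x - x = ((N x)^-1 - 1) *: x.
  by rewrite scalerBl scale1r.
rewrite NZ -[X in _ * X](ger0_norm (N_ge0 x)).
by rewrite -normrM mulrBl mulVf// mul1r.
Qed.

Section Linear.
Variable F : V -> R.
Hypothesis hF : contraction F.
Lemma linF a x y : F (a *: x + y) = a * F x + F y. Proof. exact: hF.1. Qed.
Lemma linD x y : F (x + y) = F x + F y.
Proof. by rewrite -{1}(scale1r x) linF mul1r. Qed.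
Lemma lin0 : F 0 = 0.
Proof. by have := linD 0 0; rewrite addr0; lra. Qed.
Lemma linZ a x : F (a *: x) = a * F x.
Proof. by rewrite -(addr0 (a *: x)) linF lin0 addr0. Qed.
Lemma linN x : F (- x) = - F x.
Proof. by rewrite -scaleN1r linZ mulN1r. Qed.
Lemma linB x y : F (x - y) = F x - F y.
Proof. by rewrite linD linN. Qed.
Lemma contr_le x : F x <= N x. Proof. exact: hF.2. Qed.
Lemma contr_ge x : - N x <= F x.
Proof. by have := contr_le (- x); rewrite linN NN; lra. Qed.
End Linear.

Lemma contraction_opp F : contraction F -> contraction (fun x => - F x).
Proof.
move=> hF; split=> [a x y|x]; first by rewrite (linF hF); ring.
by have := contr_ge hF x; lra.
Qed.

Lemma contraction0 : contraction (fun=> 0).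
Proof. by split=> [a x y|x]; rewrite ?mulr0 ?addr0 ?N_ge0. Qed.

Lemma contraction_comp F g :
  contraction F -> lin_isometry g -> contraction (fun x => F (g x)).
Proof.
move=> hF [gl gN]; split=> [a x y|x]; first by rewrite gl (linF hF).
by rewrite -gN; exact: contr_le.
Qed.

Section Isometry.
Variable g : V -> V.
Hypothesis hg : lin_isometry g.
Lemma isoD x y : g (x + y) = g x + g y.
Proof. by have := hg.1 1 x y; rewrite !scale1r. Qed.
Lemma iso0 : g 0 = 0.
Proof. by apply: (@addIr _ (g 0)); rewrite -isoD !add0r. Qed.
Lemma isoZ a x : g (a *: x) = a *: g x.
Proof. by rewrite -[in LHS](addr0 (a *: x)) hg.1 iso0 addr0. Qed.
Lemma isoB x y : g (x - y) = g x - g y.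
Proof. by rewrite isoD -scaleN1r isoZ scaleN1r. Qed.
End Isometry.

Lemma addrKl (U : zmodType) (a b : U) : a + b - a = b.
Proof. by rewrite addrAC subrr add0r. Qed.

(* A convex function on a short segment has a small second difference at some
   point, because its slopes stay bounded. *)
Lemma small_second_difference (e s : R) : 0 < e -> 0 < s ->
  exists2 t, 0 < t & forall x y, N y <= 1 -> exists u,
    N (u - x) <= s /\ N (u + t *: y) + N (u - t *: y) <= 2 * N u + e * t.
Proof.
(* [M] successive slope increases of [e] exceed 2, more than slopes in [[-1, 1]] allow. The segment
   of length [s] is cut into [M + 2] pieces. *)
move=> e0 s0; pose M := Num.bound (2 / e).
have M2 : 2 < M%:R * e.
  by rewrite -ltr_pdivrMr//; apply: archi_boundP; rewrite divr_ge0// ltW.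
have M3 : 0 < (M.+2)%:R :> R by rewrite ltr0n.
pose t := s / (M.+2)%:R.
have t0 : 0 < t by exact: divr_gt0.
have tM : (M.+2)%:R * t = s by rewrite mulrC divfK// gt_eqF.
exists t => // x y y1.
pose p (i : nat) := N (x + (i%:R * t) *: y).
(* If every inner node failed, each increment of [p] would exceed the previous one by more than
   [e * t], although all increments lie in [[- t, t]]. *)
apply: contrapT => /forallNP H.
have pS (i : nat) : (x + (i.+1%:R * t) *: y) = (x + (i%:R * t) *: y) + t *: y.
  by rewrite -addrA -scalerDl -addn1 natrD mulrDl mul1r.
have step (i : nat) : (i <= M)%N -> 2 * p i.+1 + e * t < p i.+2 + p i.
  move=> iM; have := H (x + (i.+1%:R * t) *: y) => /not_andP[].
    case; rewrite addrKl NZ ger0_norm; last by rewrite mulr_ge0// ltW.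
    rewrite -tM; have iM' : i.+1%:R <= (M.+2)%:R :> R by rewrite ler_nat ltnW.
    apply: (@le_trans _ _ (i.+1%:R * t)).
      by rewrite ler_piMr// mulr_ge0// ltW.
    by rewrite ler_wpM2r// ltW.
  move/negP; rewrite -ltNge -pS pS addrK -/(p i.+1) -/(p i.+2) -/(p i) -pS -/(p i.+1).
  by [].
have lip (i : nat) : `|p i.+1 - p i| <= t.
  rewrite /p pS ler_norml.
  have := N_leB (x + (i%:R * t) *: y + t *: y) (x + (i%:R * t) *: y).
  have := N_leB (x + (i%:R * t) *: y) (x + (i%:R * t) *: y + t *: y).
  rewrite NBC addrKl NZ gtr0_norm// => h1 h2.
  have : t * N y <= t by rewrite ler_piMr// ltW.
  by move=> h3; apply/andP; split; lra.
have grow (n : nat) : (n <= M.+1)%N -> p 1%N - p 0%N + n%:R * (e * t) <= p n.+1 - p n.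
  elim: n => [_|n IH nM]; first by rewrite mul0r addr0.
  have := IH (ltnW nM); have := step n nM.
  by rewrite -[n.+1%:R]natr1 mulrDl mul1r; lra.
have := grow M (leqnSn _); have := lip 0%N; have := lip M.
rewrite !ler_norml => /andP[_ h1] /andP[h2 _].
have : 2 * t < M%:R * e * t by rewrite ltr_pM2r.
by rewrite -mulrA; lra.
Qed.

(** Micro-transitivity with a radius [d] independent of the base point; [realified_umt] supplies
    it. *)
Hypothesis umt : forall e, 0 < e -> exists2 d, 0 < d & forall x y,
  N x = 1 -> N y = 1 -> N (x - y) < d ->
  exists g, [/\ lin_isometry g, g x = y & forall z, N (g z - z) <= e * N z].

(** An isometry [g] close to the identity sends [x] to the normalisation of a nearby [u] with small
    second difference in direction [y]; as [g y] is close to [y], the estimate carries over to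
    [x]. *)
Lemma uniformly_smooth (e : R) : 0 < e -> exists2 t, 0 < t & forall x y,
  N x = 1 -> N y <= 1 -> N (x + t *: y) + N (x - t *: y) <= 2 + e * t.
Proof.
move=> e0; have [d d0 Hd] := umt (e := e / 4) ltac:(lra).
pose s := Num.min (d / 4) (1 / 4).
have s0 : 0 < s by rewrite lt_min; apply/andP; split; lra.
have sd : s <= d / 4 by rewrite ge_min lexx.
have s4 : s <= 1 / 4 by rewrite ge_min lexx orbT.
have [t t0 Ht] := small_second_difference (e := e / 2) ltac:(lra) s0.
exists (t / 2); first lra.
move=> x y x1 y1; have [u [ux uy]] := Ht x y y1.
have u1 := N_leB u x; have u2 := N_leB x u; rewrite NBC in u2.
have nu : N u != 0 by rewrite gt_eqF//; lra.
have nu0 : 0 < N u by lra.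
have [|g [gi gx gz]] := Hd x ((N u)^-1 *: u) x1 (N_normalize nu).
  rewrite NBC; apply: le_lt_trans (NB_trans u _ _) _.
  rewrite N_normalizeB//; suff : `|1 - N u| <= s by lra.
  by rewrite ler_norml; apply/andP; split; lra.
pose t' := t / N u.
have t't : t / 2 <= t'.
  by rewrite /t' ler_pM2l// lef_pV2 ?posrE//; lra.
have t'0 : 0 < t' by lra.
have H1 (a : R) : `|a| = t' ->
    N (x + a *: y) <= (N u)^-1 * N (u + (a * N u) *: y) + t' * (e / 4).
  move=> at'; rewrite -(gi.2 (x + _)) (isoD gi) (isoZ gi) gx.
  apply: le_trans (N_leB _ ((N u)^-1 *: (u + (a * N u) *: y))) _.
  rewrite NZ gtr0_norm ?invr_gt0// lerD2l scalerDr scalerA.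
  rewrite [_^-1 * (a * _)]mulrC -mulrA divff// mulr1 opprD addrACA subrr add0r.
  rewrite -scalerBr NZ at' ler_wpM2l ?(ltW t'0)//.
  by apply: le_trans (gz _) _; rewrite ler_piMr//; lra.
have tu : t' * N u = t by rewrite /t' divfK.
have h1 := H1 t' (gtr0_norm t'0).
have := H1 (- t'); rewrite normrN => /(_ (gtr0_norm t'0)).
rewrite mulNr !scaleNr tu => h2; rewrite tu in h1.
have h3 : N (x + t' *: y) + N (x - t' *: y) <= 2 + e * t'.
  have : (N u)^-1 * (N (u + t *: y) + N (u - t *: y)) <= 2 + e / 2 * t'.
    by rewrite mulrC ler_pdivrMr// mulrDl -(mulrA (e / 2)) tu.
  rewrite mulrDr; lra.
(* Convexity passes from the step [t'], which depends on [u], to the smaller uniform step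
   [t / 2]. *)
pose l := t / 2 / t'.
have l0 : 0 <= l by rewrite /l !divr_ge0//; lra.
have l1 : l <= 1 by rewrite /l ler_pdivrMr// mul1r.
have lt' : l * t' = t / 2 by rewrite /l divfK// gt_eqF.
have H2 (a : R) : N (x + (l * a) *: y) <= (1 - l) + l * N (x + a *: y).
  have -> : x + (l * a) *: y = (1 - l) *: x + l *: (x + a *: y).
    by rewrite scalerDr scalerA addrA -scalerDl subrK scale1r.
  apply: le_trans (ND _ _) _; rewrite !NZ x1 mulr1 !ger0_norm//; lra.
have := H2 t'; have := H2 (- t'); rewrite mulrN lt' !scaleNr => h4 h5.
have : l * (N (x + t' *: y) + N (x - t' *: y)) <= l * (2 + e * t').
  by rewrite ler_wpM2l.
rewrite !mulrDr [l * (e * t')]mulrCA lt'; lra.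
Qed.

(** Adding [f (x + t y)] and [h (x - t y)] bounds [t * (f y - h y)] by the second difference of the
    norm at the normalised [x], up to the defects of [f] and [h] at [x]. *)
Lemma near_supports_close (e : R) : 0 < e -> exists2 d, 0 < d & forall x f h,
  N x <= 1 -> contraction f -> contraction h -> 1 - d <= f x -> 1 - d <= h x ->
  forall y, f y - h y <= e * N y.
Proof.
move=> e0; have [t t0 Ht] := uniformly_smooth (e := e / 4) ltac:(lra).
pose d := Num.min (e * t / 8) (1 / 2).
have et0 : 0 < e * t by exact: mulr_gt0.
have d0 : 0 < d by rewrite lt_min; apply/andP; split; lra.
have d1 : d <= e * t / 8 by rewrite ge_min lexx.
have d2 : d <= 1 / 2 by rewrite ge_min lexx orbT.
exists d => // x f h x1 hf hh fx hx.
have cx := contr_le hf x.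
have nx0 : 0 < N x by lra.
have nx : N x != 0 by rewrite gt_eqF.
have H y : N y = 1 -> f y - h y <= e.
  move=> y1; have := Ht _ y (N_normalize nx); rewrite y1 => /(_ (lexx _)) H.
  have := contr_le hf ((N x)^-1 *: x + t *: y).
  have := contr_le hh ((N x)^-1 *: x - t *: y).
  rewrite (linB hh) (linD hf) !(linZ hf) !(linZ hh).
  have fx' : f x <= (N x)^-1 * f x by rewrite ler_peMl ?invf_ge1//; lra.
  have hx' : h x <= (N x)^-1 * h x by rewrite ler_peMl ?invf_ge1//; lra.
  move=> H1 H2; rewrite -(ler_pM2r t0); lra.
move=> y; have [y0|y0] := eqVneq (N y) 0.
  by have := contr_le hf y; have := contr_ge hh y; rewrite y0; lra.
have := H _ (N_normalize y0); rewrite (linZ hf) (linZ hh) -mulrBr mulrC ler_pdivrMr//.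
by rewrite lt_neqAle eq_sym y0 N_ge0.
Qed.

(** * Uniform convexity *)

Hypothesis transitive : forall x y, N x = 1 -> N y = 1 ->
  exists2 g, lin_isometry g & g x = y.

Definition support (F : V -> R) (x : V) := contraction F /\ F x = 1.

Hypothesis support_ex : forall x, N x = 1 -> exists F, support F x.

Lemma norming_ex x : exists2 F, contraction F & F x = N x.
Proof.
have [x0|x0] := eqVneq (N x) 0.
  by exists (fun=> 0) => //; exact: contraction0.
have [F [hF Fx]] := support_ex (N_normalize x0).
by exists F => //; move: Fx; rewrite (linZ hF) => /(canRL (mulVKf x0)); rewrite mulr1.
Qed.

Lemma support_unique x f h : N x = 1 -> support f x -> support h x -> f = h.
Proof.
move=> x1 [hf fx] [hh hx]; apply/funext => y; apply/eqP.
have le u v : support u x -> support v x -> u y <= v y.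
  move=> [hu ux] [hv vx]; apply/ler_addgt0Pr => e e0.
  have N1 : 0 < N y + 1 by have := N_ge0 y; lra.
  have [d d0] := near_supports_close (divr_gt0 e0 N1).
  move=> /(_ x u v); rewrite x1 ux vx => /(_ (lexx _) hu hv) H.
  have := H ltac:(lra) ltac:(lra) y; rewrite mulrAC.
  have : e * N y / (N y + 1) <= e by rewrite ler_pdivrMr// ler_pM2l//; lra.
  lra.
by rewrite eq_le !le.
Qed.

(** Arbitrarily thin slices contain points at distance [D] or more from their centre [x]. The centre
    may vary with [b]; [far_everywhere] removes this freedom. *)
Definition far (D : R) := forall b, 0 < b -> exists x F w,
  [/\ N x = 1, support F x, N w <= 1, 1 - b <= F w & D <= N (x - w)].

(** An isometry carries the witness from [y] to [x], and by uniqueness of support functionals it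
    carries the slice along. *)
Lemma far_everywhere D x F : far D -> N x = 1 -> support F x ->
  forall b, 0 < b -> exists w, [/\ N w <= 1, 1 - b <= F w & D <= N (x - w)].
Proof.
move=> hD x1 hF b b0; have [y [G [w [y1 hG w1 Gw Dw]]]] := hD b b0.
have [g gi gy] := transitive y1 x1.
have hG' : support (fun z => F (g z)) y.
  by split; [apply: contraction_comp gi; exact: hF.1|rewrite gy; exact: hF.2].
exists (g w); rewrite gi.2; split => //.
  by rewrite (_ : F (g w) = G w)// (support_unique y1 hG hG').
by rewrite -gy -(isoB gi) gi.2.
Qed.

Lemma not_far D : ~ far D -> exists2 b, 0 < b & forall x F w,
  N x = 1 -> support F x -> N w <= 1 -> 1 - b <= F w -> N (x - w) < D.
Proof.
move=> /existsNP[b /not_implyP[b0 H]]; exists b => // x F w x1 hF w1 Fw.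
by rewrite ltNge; apply/negP => Dw; apply: H; exists x, F, w.
Qed.

Definition slice (F : V -> R) (b : R) (w : V) := N w <= 1 /\ 1 - b <= F w.

Lemma slice_mono F b c w : b <= c -> slice F b w -> slice F c w.
Proof. by move=> bc [w1 Fw]; split => //; lra. Qed.

(** * Slices at the critical distance and separated sequences *)

Section Separation.
Variables (D : R) (x0 : V) (F0 : V -> R).
Hypotheses (D0 : 0 < D) (x01 : N x0 = 1) (hF0 : support F0 x0).
Hypothesis far_below : forall D', D' < D -> far D'.
Hypothesis far_above : forall D', D < D' -> ~ far D'.

Lemma slice_normalize b u : b <= 1 / 2 -> slice F0 b u ->
  [/\ N u != 0, N ((N u)^-1 *: u) = 1, 1 - b <= F0 ((N u)^-1 *: u)
    & N ((N u)^-1 *: u - u) <= b].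
Proof.
move=> b2 [u1 Fu]; have uF := contr_le hF0.1 u.
have u0 : N u != 0 by rewrite gt_eqF//; lra.
split => //; first exact: N_normalize.
  rewrite (linZ hF0.1); apply: (le_trans Fu).
  by rewrite ler_peMl ?invf_ge1//; lra.
by rewrite N_normalizeB// ger0_norm; lra.
Qed.

(** [F0] almost supports the normalisation of [u], so it is close to the support functional there.
    Hence its slice lies in a slightly thicker slice at that point, of radius below [D + e / 2]. *)
Lemma slice_diam e : 0 < e -> exists2 b, 0 < b & forall u w,
  slice F0 b u -> slice F0 b w -> N (u - w) <= D + e.
Proof.
move=> e0; have [b b0 Hb] := not_far (far_above (D' := D + e / 2) ltac:(lra)).
have [d d0 Hd] := near_supports_close (e := b / 2) ltac:(lra).
pose c := Num.min (Num.min d (b / 2)) (Num.min (e / 2) (1 / 2)).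
have c0 : 0 < c by rewrite !lt_min; do ?(apply/andP; split); lra.
have cd : c <= d by rewrite /c !ge_min lexx.
have cb : c <= b / 2 by rewrite /c !ge_min lexx orbT.
have ce : c <= e / 2 by rewrite /c !ge_min lexx !orbT.
have c2 : c <= 1 / 2 by rewrite /c !ge_min lexx !orbT.
exists c => // u w hu [w1 Fw].
have [u0 u1 Fu uu] := slice_normalize c2 hu.
have [F hF] := support_ex u1.
have h : F0 w - F w <= b / 2 * N w.
  apply: (Hd ((N u)^-1 *: u)) => //; rewrite ?u1//; [exact: hF0.1|exact: hF.1|lra|].
  by rewrite hF.2; lra.
have : b / 2 * N w <= b / 2 by rewrite ler_piMr//; lra.
have := Hb _ F w u1 hF w1.
have := NB_trans ((N u)^-1 *: u) u w; rewrite (NBC u (_ *: _)).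
move=> h1 h2 h3; have := h2 ltac:(lra); lra.
Qed.

(** The comparison of [slice_diam] in the other direction: a far point of a thin slice at the
    normalisation of [u] also lies in a slice of [F0]. *)
Lemma slice_extend b : 0 < b -> exists2 c, 0 < c & forall u,
  slice F0 c u -> exists2 w, slice F0 b w & D - b <= N (u - w).
Proof.
move=> b0; have [d d0 Hd] := near_supports_close (e := b / 2) ltac:(lra).
pose c := Num.min (Num.min d (b / 2)) (1 / 2).
have c0 : 0 < c by rewrite !lt_min; do ?(apply/andP; split); lra.
have cd : c <= d by rewrite /c !ge_min lexx.
have cb : c <= b / 2 by rewrite /c !ge_min lexx orbT.
have c2 : c <= 1 / 2 by rewrite /c !ge_min lexx !orbT.
exists c => // u hu; have [u0 u1 Fu uu] := slice_normalize c2 hu.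
have [F hF] := support_ex u1.
have [w [w1 Fw Dw]] := far_everywhere (far_below (D' := D - b / 2) ltac:(lra))
  u1 hF (b := b / 2) ltac:(lra).
exists w.
  split => //; have h : F w - F0 w <= b / 2 * N w.
    apply: (Hd ((N u)^-1 *: u)) => //; rewrite ?u1//; [exact: hF.1|exact: hF0.1| |lra].
    by rewrite hF.2; lra.
  have : b / 2 * N w <= b / 2 by rewrite ler_piMr//; lra.
  lra.
by have := NB_trans u ((N u)^-1 *: u) w; lra.
Qed.

Lemma slice_mean b n (x : nat -> V) : (forall i, (i <= n)%N -> slice F0 b (x i)) ->
  slice F0 b ((n.+1%:R)^-1 *: \sum_(i < n.+1) x i).
Proof.
move=> H; have n0 : 0 < n.+1%:R :> R by rewrite ltr0n.
have sumN : N (\sum_(i < n.+1) x i) <= \sum_(i < n.+1) N (x i).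
  elim/big_ind2: _ => [|u a v c ua vc|//]; first by rewrite N0.
  by apply: le_trans (ND _ _) _; exact: lerD.
have sumF : F0 (\sum_(i < n.+1) x i) = \sum_(i < n.+1) F0 (x i).
  by apply: big_morph => [u v|]; [exact: (linD hF0.1)|exact: (lin0 hF0.1)].
have cst (a : R) : \sum_(i < n.+1) a = a * n.+1%:R.
  by rewrite sumr_const card_ord mulr_natr.
split.
  rewrite NZ// ger0_norm ?invr_ge0 ?ler0n// mulrC ler_pdivrMr//.
  apply: le_trans sumN _; rewrite -cst; apply: ler_sum => i _.
  by have [] := H i (ltnSE (ltn_ord i)).
rewrite (linZ hF0.1) mulrC ler_pdivlMr// sumF -cst; apply: ler_sum => i _.
by have [] := H i (ltnSE (ltn_ord i)).
Qed.

(** The new point [w] is far from the mean [m] of the earlier ones, and [F] norms [m - w]. No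
    [F (x k - w)] exceeds [D + e] while their average is almost [D], so each is almost [D]. *)
Lemma separated_sequence n b : 0 < b -> exists (x : nat -> V) (f : nat -> V -> R),
  [/\ forall i, (i <= n)%N -> slice F0 b (x i),
      forall i, contraction (f i) &
      forall i j, (i < j <= n)%N -> D - b <= f j (x i - x j)].
Proof.
elim: n b => [|n IH] b b0.
  exists (fun=> x0), (fun _ _ => 0); split => [i _|i|i j].
  - by split; rewrite ?x01// hF0.2; lra.
  - exact: contraction0.
  - by rewrite ltnNge leqn0; case: eqP => [->|]; rewrite ?leq0n ?andbF.
have n0 : 0 < n.+1%:R :> R by rewrite ltr0n.
(* Each term of the average is at least [(n+1) (D - e) - n (D + e) = D - (2n+1) e], which must stay
   above [D - b]. *)
pose e := b / (2 * n.+1%:R).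
have e0 : 0 < e by rewrite divr_gt0// mulr_gt0.
have eE : 2 * n.+1%:R * e = b by rewrite mulrC divfK// gt_eqF// mulr_gt0.
have [bd bd0 Hd] := slice_diam e0.
pose c := Num.min b (Num.min bd e).
have c0 : 0 < c by rewrite !lt_min; do ?(apply/andP; split).
have cb : c <= b by rewrite /c !ge_min lexx.
have cbd : c <= bd by rewrite /c !ge_min lexx !orbT.
have ce : c <= e by rewrite /c !ge_min lexx !orbT.
have [c' c'0 Hc'] := slice_extend c0.
(* Thin enough for the mean to admit a far point [w], and for the earlier points to be within
   [D + e] of [w]. *)
pose a := Num.min c c'.
have a0 : 0 < a by rewrite !lt_min; do ?(apply/andP; split).
have ac : a <= c by rewrite /a ge_min lexx.
have ac' : a <= c' by rewrite /a ge_min lexx orbT.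
have [x [f [hx hf hD]]] := IH a a0.
set m := (n.+1%:R)^-1 *: \sum_(i < n.+1) x i.
have [w hw Dw] := Hc' m (slice_mono ac' (slice_mean hx)).
have [F hF Fm] := norming_ex (m - w).
exists (fun i => if (i <= n)%N then x i else w).
exists (fun i => if (i <= n)%N then f i else F).
split => [i _|i|i j /andP[ij jn]].
- case: leqP => [i_n|_]; last exact: slice_mono hw.
  exact: slice_mono (le_trans ac cb) (hx i i_n).
- by case: ifP.
have i_n : (i <= n)%N by exact: leq_trans ij jn.
rewrite i_n; case: (leqP j n) => jn'.
  apply: le_trans (hD i j _); last by rewrite ij.
  by rewrite lerD2l lerN2 (le_trans ac).
have le1 (k : nat) : (k <= n)%N -> F (x k - w) <= D + e.
  move=> kn; apply: le_trans (contr_le hF _) _; apply: Hd.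
    exact: slice_mono (le_trans ac cbd) (hx k kn).
  exact: slice_mono cbd hw.
have sumE : \sum_(k < n.+1) F (x k - w) = n.+1%:R * F (m - w).
  have -> : \sum_(k < n.+1) F (x k - w) = \sum_(k < n.+1) F (x k) - n.+1%:R * F w.
    under eq_bigr do rewrite (linB hF).
    by rewrite sumrB sumr_const card_ord mulr_natl.
  rewrite (linB hF) mulrBr /m (linZ hF) mulrA divff ?gt_eqF// mul1r; congr (_ - _).
  by apply/esym/big_morph => [u v|]; [exact: (linD hF)|exact: (lin0 hF)].
have : \sum_(k < n.+1) F (x k - w) <= F (x i - w) + n%:R * (D + e).
  have ilt : (i < n.+1)%N by [].
  rewrite (bigD1 (Ordinal ilt))//= lerD2l.
  have -> : n%:R * (D + e) = \sum_(k < n.+1 | k != Ordinal ilt) (D + e).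
    by rewrite sumr_const cardC1 card_ord mulr_natl.
  by apply: ler_sum => k _; apply: le1; exact: ltnSE.
rewrite sumE Fm => H.
have : n.+1%:R * (D - e) <= n.+1%:R * N (m - w) by rewrite ler_pM2l//; lra.
move: H eE; rewrite -[n.+1%:R]natr1; nra.
Qed.

End Separation.

(** * Decay of dyadic means *)

Lemma expr_lt_eventually (rho e : R) : 0 <= rho < 1 -> 0 < e -> exists d, rho ^+ d < e.
Proof.
move=> /andP[r0 r1] e0; have t0 : 0 < 1 - rho by lra.
have bern d : rho ^+ d * (1 + d%:R * (1 - rho)) <= 1.
  elim: d => [|d IH]; first by rewrite expr0 mul0r; lra.
  apply: le_trans IH; rewrite exprS -mulrA mulrCA ler_wpM2l ?exprn_ge0//.
  have : 0 <= d%:R * (1 - rho) ^+ 2 by rewrite mulr_ge0// sqr_ge0.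
  by rewrite -natr1; nra.
pose d := Num.bound (e^-1 / (1 - rho)); exists d.
have de : e^-1 < d%:R * (1 - rho).
  by rewrite -ltr_pdivrMr//; apply: archi_boundP; rewrite divr_ge0 ?invr_ge0// ltW.
have d0 : 0 < 1 + d%:R * (1 - rho).
  by apply: addr_gt0 => //; apply: lt_trans de; rewrite invr_gt0.
have : e * e^-1 = 1 by rewrite divff// gt_eqF.
have := bern d; rewrite -ler_pdivlMr// mul1r => /le_lt_trans h ee; apply: h.
rewrite -[ltLHS]mul1r ltr_pdivrMr// -[ltLHS]ee ltr_pM2l//; lra.
Qed.

(** The average of [f a], ..., [f (a + 2 ^ d - 1)], built as a binary tree so that each node
    averages two adjacent blocks. *)
Fixpoint dyadic_mean (f : nat -> V -> R) (d a : nat) : V -> R :=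
  if d is d'.+1 then
    fun z => (dyadic_mean f d' a z + dyadic_mean f d' (a + 2 ^ d') z) / 2
  else f a.

Lemma dyadic_mean_ge f z c d a :
  (forall i, (a <= i < a + 2 ^ d)%N -> c <= f i z) -> c <= dyadic_mean f d a z.
Proof.
elim: d a => [|d IH] a H /=; first by apply: H; lia.
have h1 : c <= dyadic_mean f d a z by apply: IH => i hi; apply: H; rewrite expnS; lia.
have h2 : c <= dyadic_mean f d (a + 2 ^ d) z.
  by apply: IH => i hi; apply: H; rewrite expnS; lia.
lra.
Qed.

Lemma dyadic_mean_le f z c d a :
  (forall i, (a <= i < a + 2 ^ d)%N -> f i z <= c) -> dyadic_mean f d a z <= c.
Proof.
elim: d a => [|d IH] a H /=; first by apply: H; lia.
have h1 : dyadic_mean f d a z <= c by apply: IH => i hi; apply: H; rewrite expnS; lia.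
have h2 : dyadic_mean f d (a + 2 ^ d) z <= c.
  by apply: IH => i hi; apply: H; rewrite expnS; lia.
lra.
Qed.

Lemma dyadic_mean_lin f d a : (forall i, contraction (f i)) ->
  forall s x y, dyadic_mean f d a (s *: x + y) =
    s * dyadic_mean f d a x + dyadic_mean f d a y.
Proof.
move=> hf; elim: d a => [|d IH] a s x y /=; first exact: (linF (hf a)).
by rewrite !IH; ring.
Qed.

(* The dual norm is uniformly convex (this is what [near_supports_close] says),
   so averaging two separated functionals shrinks the norm by a fixed factor. *)
Lemma dyadic_mean_decay (c : R) : 0 < c -> exists2 rho, 0 <= rho < 1 &
  forall f (z : nat -> V) n, (forall i, contraction (f i)) ->
  (forall k, (k <= n)%N -> N (z k) <= 1) ->
  (forall i k, (i < k <= n)%N -> c <= f i (z k)) ->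
  (forall i k, (k <= i <= n)%N -> f i (z k) <= c / 2) ->
  forall d a v, (a + 2 ^ d <= n.+1)%N -> dyadic_mean f d a v <= rho ^+ d * N v.
Proof.
move=> c0; have [d0 d00 Hd] := near_supports_close (e := c / 4) ltac:(lra).
pose dl := Num.min d0 1.
have dl0 : 0 < dl by rewrite lt_min d00 ltr01.
have dl1 : dl <= 1 by rewrite ge_min lexx orbT.
have dld : dl <= d0 by rewrite ge_min lexx.
exists (1 - dl / 2); first by apply/andP; split; lra.
set rho := 1 - _; have r0 : 0 < rho by rewrite /rho; lra.
have r1 : rho <= 1 by rewrite /rho; lra.
move=> f z n hf z1 hlo hup; elim => [|d IH] a v han /=.
  by rewrite expr0 mul1r; exact: contr_le (hf a) _.
have han1 : (a + 2 ^ d <= n.+1)%N by move: han; rewrite expnS; lia.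
have han2 : (a + 2 ^ d + 2 ^ d <= n.+1)%N by move: han; rewrite expnS; lia.
have p2 : (0 < 2 ^ d)%N by rewrite expn_gt0.
have k_n : (a + 2 ^ d <= n)%N by lia.
set g := dyadic_mean f d a; set h := dyadic_mean f d _.
pose r := rho ^+ d; have rp : 0 < r by exact: exprn_gt0.
have r_le1 : r <= 1 by apply: exprn_ile1 => //; exact: ltW.
have hg : contraction (fun x => r^-1 * g x).
  split=> [s x y|x]; first by rewrite /g dyadic_mean_lin//; ring.
  by rewrite mulrC ler_pdivrMr// mulrC; exact: IH.
have hh : contraction (fun x => r^-1 * h x).
  split=> [s x y|x]; first by rewrite /h dyadic_mean_lin//; ring.
  by rewrite mulrC ler_pdivrMr// mulrC; exact: IH.
(* If the bound fails at [v], both halves, rescaled by [r^-1] to contractions, almost norm [v] and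
   so differ by at most [c / 4] on the unit ball. *)
rewrite leNgt; apply/negP => Hv.
have gv := IH a v han1; have hv := IH (a + 2 ^ d)%N v han2.
rewrite -/g -/h -/r in gv hv.
have [v0|v0] := eqVneq (N v) 0; first by move: Hv gv hv; rewrite v0 !mulr0; lra.
have vp : 0 < N v by rewrite lt_neqAle eq_sym v0 N_ge0.
have near (F : V -> R) : contraction (fun x => r^-1 * F x) ->
    (2 * rho - 1) * r * N v <= F v ->
    1 - d0 <= r^-1 * F ((N v)^-1 *: v).
  move=> hF Fv; have -> : r^-1 * F ((N v)^-1 *: v) = (N v)^-1 * (r^-1 * F v).
    exact: (linZ hF).
  rewrite mulrC ler_pdivlMr// mulrC [r^-1 * _]mulrC ler_pdivlMr//; apply: le_trans Fv.
  rewrite [N v * _]mulrC -!mulrA [N v * r]mulrC ler_pM2r ?mulr_gt0// /rho; lra.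
have v1 : N ((N v)^-1 *: v) <= 1 by rewrite (N_normalize v0).
rewrite exprS -/r in Hv.
have g1 : 1 - d0 <= r^-1 * g ((N v)^-1 *: v) by apply: near => //; nra.
have h1 : 1 - d0 <= r^-1 * h ((N v)^-1 *: v) by apply: near => //; nra.
(* The point indexed by the border between the blocks separates them: the left half is at least [c]
   there, the right half at most [c / 2]. *)
have := Hd _ _ _ v1 hg hh g1 h1 (z (a + 2 ^ d)%N).
have zk := z1 _ k_n.
have glo : c <= g (z (a + 2 ^ d)%N) 
  by apply: dyadic_mean_ge => i /andP[_ hi]; apply: hlo; rewrite hi.
have hhi : h (z (a + 2 ^ d)%N) <= c / 2.
  apply: dyadic_mean_le => i /andP[hi hi']; apply: hup.
  by rewrite hi -ltnS (leq_trans hi').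
have : c / 4 * N (z (a + 2 ^ d)%N) <= c / 4 by rewrite ler_piMr//; lra.
rewrite -mulrBr => h2 h3; have := le_trans h3 h2.
rewrite mulrC ler_pdivrMr//; have : c / 4 * r <= c / 4 by rewrite ler_piMr//; lra.
lra.
Qed.

(** A critical distance would give separated sequences of any length; the odd-indexed functionals
    then have dyadic means that decay geometrically, yet stay at least [c / 2] at one point of the
    ball. *)
Lemma no_separation D : 0 < D -> (exists x, N x = 1) ->
  (forall D', D' < D -> far D') -> (forall D', D < D' -> ~ far D') -> False.
Proof.
have idx1 (i k n : nat) : (i < k <= n)%N ->
    (0 < (2 * i).+1 < 2 * k)%N /\ (2 * k <= (2 * n).+1)%N by lia.
have idx2 (i k n : nat) : (k <= i <= n)%N ->
    (2 * k < (2 * i).+1 <= (2 * n).+1)%N by lia.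
move=> D0 [x0 x01] below above; have [F0 hF0] := support_ex x01.
have [d d0 Hd] := near_supports_close (e := 1 / 4) ltac:(lra).
pose c := Num.min (d / 2) (1 / 2).
have c0 : 0 < c by rewrite lt_min; apply/andP; split; lra.
have cd : c <= d / 2 by rewrite ge_min lexx.
have c2 : c <= 1 / 2 by rewrite ge_min lexx orbT.
have [rho rho01 decay] := dyadic_mean_decay (c := c / 2) ltac:(lra).
have [p rhop] := expr_lt_eventually rho01 (e := c / 2) ltac:(lra).
have cD : 0 < c * D by exact: mulr_gt0.
pose e := Num.min (D / 16) (c * D / 4).
have e0 : 0 < e by rewrite lt_min; apply/andP; split; lra.
have eD : e <= D / 16 by rewrite ge_min lexx.
have ec : e <= c * D / 4 by rewrite ge_min lexx orbT.
have cdD : c * D <= d / 2 * D by rewrite ler_pM2r.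
have [b b0 diam] := slice_diam hF0 above e0.
pose b' := Num.min b e.
have b'0 : 0 < b' by rewrite lt_min b0.
have b'b : b' <= b by rewrite ge_min lexx.
have b'e : b' <= e by rewrite ge_min lexx orbT.
have [n nE] : exists n, n = (2 ^ p)%N by exists (2 ^ p)%N.
have [x [f [hx hf sep]]] := separated_sequence
  x01 hF0 below above (2 * n).+1 b'0.
have lo i j : (i < j <= (2 * n).+1)%N -> D - e <= f j (x i - x j).
  by move=> ij; have := sep i j ij; lra.
have up i j : (i <= (2 * n).+1)%N -> (j <= (2 * n).+1)%N -> N (x i - x j) <= D + e.
  by move=> hi hj; apply: diam; apply: slice_mono b'b _; exact: hx.
(* Otherwise [f m] and [- f j] both nearly norm [x j - x m], so they are close,
   contradicting their values at [x 0 - x j]. *)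
have later j m : (0 < j < m)%N -> (m <= (2 * n).+1)%N -> c * D <= f j (x 0%N - x m).
  move=> /andP[j0 jm] mn; rewrite leNgt; apply/negP => small.
  have De : 0 < D + e by lra.
  pose u := (D + e)^-1 *: (x j - x m).
  have u1 : N u <= 1.
    rewrite NZ// gtr0_norm ?invr_gt0// mulrC ler_pdivrMr// mul1r up//.
    by apply: leq_trans mn; exact: ltnW.
  have jn : (j <= (2 * n).+1)%N by apply: leq_trans mn; exact: ltnW.
  have lo0j : D - e <= f j (x 0%N - x j) by rewrite lo// j0.
  have lo0m : D - e <= f m (x 0%N - x m) by rewrite lo// mn (ltn_trans j0).
  have lojm : D - e <= f m (x j - x m) by rewrite lo// mn jm.
  have upjm : f m (x j - x m) <= D + e by apply: le_trans (contr_le (hf m) _) _; exact: up.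
  have hN := contraction_opp (hf j).
  have edD : e <= d * D / 8 by lra.
  have ed : d * e <= d * (D / 16) by rewrite ler_pM2l.
  have H1 : 1 - d <= f m u.
    by rewrite /u (linZ (hf m)) mulrC ler_pdivlMr//; nra.
  have H2 : 1 - d <= - f j u.
    rewrite /u (linZ (hf j)) -mulrN mulrC ler_pdivlMr//.
    move: small lo0j; rewrite !(linB (hf j)); nra.
  (* At [x 0 - x j] the value of [f j] is at least [D - e] and that of [f m] at least [- 2 e], too
     much for a sum bounded by a quarter of the norm. *)
  have := Hd u _ _ u1 (hf m) hN H1 H2 (x 0%N - x j).
  have := up 0%N j isT jn.
  move: lo0j lo0m lojm upjm; rewrite !(linB (hf m)); lra.
(* Odd indices for functionals and even ones for points: [i < k] gives [2i + 1 < 2k], where [later]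
   applies, and [k <= i] gives [2k < 2i + 1], where [lo] makes the unscaled value at most [2 e]. *)
pose g i := f (2 * i).+1.
pose z k := (2 * D)^-1 *: (x 0%N - x (2 * k)%N).
have D2 : 0 < 2 * D by lra.
have z1 k : (k <= n)%N -> N (z k) <= 1.
  move=> kn; rewrite NZ// gtr0_norm ?invr_gt0// mulrC ler_pdivrMr// mul1r.
  have k2 : (2 * k <= (2 * n).+1)%N by rewrite leqW// leq_mul2l kn.
  by have := up 0%N (2 * k)%N isT k2; lra.
have zlo i k : (i < k <= n)%N -> c / 2 <= g i (z k).
  move=> ikn; rewrite /g (linZ (hf _)) ler_pdivlMl//.
  by have [h1 h2] := idx1 _ _ _ ikn; have := later _ _ h1 h2; lra.
have zup i k : (k <= i <= n)%N -> g i (z k) <= c / 2 / 2.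
  move=> kin; rewrite /g (linZ (hf _)) ler_pdivrMl//.
  have h := idx2 _ _ _ kin; have := lo _ _ h.
  case/andP: h => _ h; have := up 0%N (2 * i).+1 isT h.
  have := contr_le (hf (2 * i).+1) (x 0%N - x (2 * i).+1).
  rewrite !(linB (hf _)); lra.
have := decay g z n (fun i => hf _) z1 zlo zup p 0%N (z n).
rewrite add0n -nE => /(_ (leqnSn _)).
have : c / 2 <= dyadic_mean g p 0 (z n).
  apply: dyadic_mean_ge => i /andP[_]; rewrite add0n -nE => hi.
  by apply: zlo; rewrite hi leqnn.
have : rho ^+ p * N (z n) <= rho ^+ p.
  by rewrite ler_piMr ?z1// exprn_ge0//; case/andP: rho01.
lra.
Qed.

(** Otherwise the supremum of the far distances, between [e] and 2, is a critical distance, which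
    [no_separation] excludes. *)
Lemma uniformly_convex (e : R) : 0 < e -> exists2 d, 0 < d & forall x F w,
  N x = 1 -> support F x -> N w <= 1 -> 1 - d <= F w -> N (x - w) < e.
Proof.
move=> e0; apply: not_far => fe.
have [x [F [w [x1 _ _ _ _]]]] := fe 1 ltr01.
have far_mono D D' : D' <= D -> far D -> far D'.
  move=> DD fD b b0; have [y [G [v [y1 hG v1 Gv Dv]]]] := fD b b0.
  by exists y, G, v; split => //; exact: le_trans Dv.
have hs : has_sup [set D | far D].
  split; first by exists e.
  exists 2 => D /(_ 1 ltr01)[y [G [v [y1 _ v1 _ Dv]]]].
  by apply: (le_trans Dv); apply: le_trans (ND _ _) _; rewrite NN// y1; lra.
apply: (@no_separation (sup [set D | far D])).
- by apply: lt_le_trans e0 _; exact: sup_upper_bound.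
- by exists x.
- move=> D' D'D; have sD : 0 < sup [set D | far D] - D' by rewrite subr_gt0.
  have [D fD] := sup_adherent sD hs; rewrite opprB addrC subrK => D'lt.
  exact: far_mono (ltW D'lt) fD.
- by move=> D' D'D fD; have := sup_upper_bound hs fD; rewrite leNgt D'D.
Qed.
End RealSeminorm.

(** * Scalars and norms *)

Definition of_real (R : realType) (k : scalar_kind) : R -> scalars R k :=
  match k return R -> scalars R k with
  | RealScalars => fun r => r
  | ComplexScalars => fun r => (r%:C)%C
  end.

Section Scalars.
Variables (R : realType) (k : scalar_kind).
Local Notation K := (scalars R k).
Local Notation ofr := (@of_real R k).

Lemma of_realD r s : ofr (r + s) = ofr r + ofr s.
Proof. by case: k => //=; rewrite rmorphD. Qed.
Lemma of_realM r s : ofr (r * s) = ofr r * ofr s.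
Proof. by case: k => //=; rewrite rmorphM. Qed.
Lemma of_real0 : ofr 0 = 0. Proof. by case: k. Qed.
Lemma of_real1 : ofr 1 = 1. Proof. by case: k. Qed.
Lemma of_realK r : to_real (ofr r) = r. Proof. by case: k r. Qed.
Lemma ler_of_real r s : (ofr r <= ofr s) = (r <= s).
Proof. by case: k => //=; exact: lecR. Qed.
Lemma ltr_of_real r s : (ofr r < ofr s) = (r < s).
Proof. by case: k => //=; exact: ltcR. Qed.

Lemma to_realD (a b : K) : to_real (a + b) = to_real a + to_real b.
Proof. by case: k a b => //= -[? ?] [? ?]. Qed.
Lemma to_realM r (a : K) : to_real (ofr r * a) = r * to_real a.
Proof. by case: k a => //= -[? ?] /=; rewrite mul0r subr0. Qed.
Lemma to_real_ge0K (a : K) : 0 <= a -> ofr (to_real a) = a.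
Proof. by case: k a => //= a a0; rewrite RRe_real// ger0_real. Qed.

Lemma normK_sabs (a : K) : `|a| = ofr (sabs a).
Proof. by rewrite to_real_ge0K. Qed.
Lemma sabs_ge0 (a : K) : 0 <= sabs a.
Proof. by rewrite -ler_of_real of_real0 -normK_sabs. Qed.
Lemma sabs_eq (a : K) r : `|a| = ofr r -> sabs a = r.
Proof. by rewrite /sabs => ->; rewrite of_realK. Qed.
Lemma sabsM (a b : K) : sabs (a * b) = sabs a * sabs b.
Proof. by apply: sabs_eq; rewrite normrM !normK_sabs of_realM. Qed.
Lemma sabsD (a b : K) : sabs (a + b) <= sabs a + sabs b.
Proof. by rewrite -ler_of_real of_realD -!normK_sabs ler_normD. Qed.
Lemma sabs0 : sabs (0 : K) = 0.
Proof. by apply: sabs_eq; rewrite normr0 of_real0. Qed.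
Lemma sabs1 : sabs (1 : K) = 1.
Proof. by apply: sabs_eq; rewrite normr1 of_real1. Qed.
Lemma sabs_eq0 (a : K) : sabs a = 0 -> a = 0.
Proof. by move=> a0; apply: normr0_eq0; rewrite normK_sabs a0 of_real0. Qed.
Lemma sabs_of_real r : sabs (ofr r) = `|r|.
Proof.
apply: sabs_eq; have [r0|r0] := leP 0 r.
  have h : 0 <= ofr r by rewrite -of_real0 ler_of_real.
  by rewrite (ger0_norm h) ger0_norm.
have h : ofr r < 0 by rewrite -of_real0 ltr_of_real.
by rewrite (ltr0_norm h) ltr0_norm//; case: (k) => //=; rewrite rmorphN.
Qed.
Lemma to_real_le (a : K) : to_real a <= sabs a.
Proof.
rewrite /sabs; case: k a => /= a; first exact: ler_norm.
by apply: le_trans (ler_norm _) _; have := normc_ge_Re a; rewrite lecE => /andP[].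
Qed.

Lemma phaseP (a : K) : exists2 th, sabs th = 1 & th * a = ofr (sabs a).
Proof.
have [a0|a0] := eqVneq a 0; first by exists 1; rewrite ?sabs1// a0 sabs0 mulr0 of_real0.
exists (`|a| / a); last by rewrite divfK// normK_sabs.
by apply: sabs_eq; rewrite normrM normr_id -normrM divff// normr1 of_real1.
Qed.
End Scalars.

Section Norm.
Variables (R : realType) (k : scalar_kind) (X : normedModType (scalars R k)).
Local Notation K := (scalars R k).
Local Notation ofr := (@of_real R k).
Implicit Types x y : X.

Lemma norm_nrm x : `|x| = ofr (nrm x).
Proof. by rewrite to_real_ge0K. Qed.
Lemma nrm_ge0 x : 0 <= nrm x.
Proof. by rewrite -(ler_of_real k) of_real0 -norm_nrm. Qed.
Lemma nrmD x y : nrm (x + y) <= nrm x + nrm y.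
Proof. by rewrite -(ler_of_real k) of_realD -!norm_nrm ler_normD. Qed.
Lemma nrmZ (a : K) x : nrm (a *: x) = sabs a * nrm x.
Proof. by rewrite [LHS]/nrm normrZ norm_nrm normK_sabs -of_realM of_realK. Qed.
Lemma nrm0 : nrm (0 : X) = 0.
Proof. by rewrite -(scale0r 0) nrmZ sabs0 mul0r. Qed.
Lemma nrmN x : nrm (- x) = nrm x.
Proof. by rewrite /nrm normrN. Qed.
Lemma nrm_eq0 x : nrm x = 0 -> x = 0.
Proof. by move=> x0; apply: normr0_eq0; rewrite norm_nrm x0 of_real0. Qed.
Lemma nrmBC x y : nrm (x - y) = nrm (y - x).
Proof. by rewrite -nrmN opprB. Qed.
Lemma nrmB_trans y x z : nrm (x - z) <= nrm (x - y) + nrm (y - z).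
Proof. by have := nrmD (x - y) (y - z); rewrite addrA subrK. Qed.
Lemma nrm_leB x y : nrm x <= nrm y + nrm (x - y).
Proof. by have := nrmD y (x - y); rewrite addrC subrK. Qed.

(** Restriction of scalars to the reals, through which the results on real seminorms apply over both
    fields. *)
Definition realified : Type := X.
HB.instance Definition _ := GRing.Zmodule.on realified.
Let rscale (r : R) (x : realified) : realified := ofr r *: (x : X).
Let rscaleA a b (x : realified) : rscale a (rscale b x) = rscale (a * b) x.
Proof. by rewrite /rscale scalerA of_realM. Qed.
Let rscale1 : left_id 1 rscale.
Proof. by move=> x; rewrite /rscale of_real1 scale1r. Qed.
Let rscaleDr : right_distributive rscale +%R.
Proof. by move=> a x y; rewrite /rscale scalerDr. Qed.
Let rscaleDl (x : realified) : {morph rscale^~ x : a b / a + b}.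
Proof. by move=> a b; rewrite /rscale of_realD scalerDl. Qed.
HB.instance Definition _ := GRing.Zmodule_isLmodule.Build R realified
  rscaleA rscale1 rscaleDr rscaleDl.

Lemma realifiedZ (r : R) (x : realified) : r *: x = ofr r *: (x : X).
Proof. by []. Qed.

Lemma nrm_seminorm : @seminorm R realified (@nrm R k X).
Proof.
split=> [x y|a x]; first exact: nrmD.
by rewrite realifiedZ nrmZ sabs_of_real.
Qed.
End Norm.

Section Complete.
Variables (R : realType) (k : scalar_kind) (X : completeNormedModType (scalars R k)).

Lemma cauchy_limit (u : nat -> X) :
  (forall e : R, 0 < e -> exists n, forall m, (n <= m)%N -> nrm (u m - u n) <= e) ->
  exists l, forall e : R, 0 < e ->
    exists n, forall m, (n <= m)%N -> nrm (u m - l) <= e.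
Proof.
move=> H.
(* A positive scalar is real, also over the complex numbers. *)
have ofP (e : scalars R k) : 0 < e -> exists2 r : R, 0 < r & e = of_real k r.
  move=> e0; have eE := to_real_ge0K (ltW e0); exists (to_real e); last by rewrite eE.
  by rewrite -(ltr_of_real k) of_real0 eE.
have uc : cauchy (u @ \oo)%classic.
  apply: cauchy_exP => e /ofP[r r0 ->].
  have [n Hn] := H (r / 2) ltac:(lra); exists (u n), n => // m /= nm.
  rewrite -ball_normE /= norm_nrm ltr_of_real nrmBC.
  by apply: le_lt_trans (Hn m nm) _; lra.
have uv : cvg (u @ \oo)%classic by exact: cauchy_cvg.
have [l ul] := (cvg_ex _).1 uv.
exists l => e e0; have e0' : 0 < of_real k e by rewrite -(of_real0 R k) ltr_of_real.
have [n _ Hn] := (cvgrPdist_le u l).1 ul _ e0'.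
by exists n => m nm; have := Hn m nm; rewrite /= norm_nrm ler_of_real nrmBC.
Qed.
End Complete.

(** * Transitivity *)

Section SphereChain.
Variables (R : realType) (V : lmodType R) (N : V -> R).
Hypothesis Nsemi : seminorm N.

Lemma normalize_lipschitz a b : N a != 0 -> N b != 0 ->
  N ((N b)^-1 *: b - (N a)^-1 *: a) <= 2 * (N (b - a) / N a).
Proof.
move=> a0 b0.
have ap : 0 < N a by rewrite lt_neqAle eq_sym a0 N_ge0.
have bp : 0 < N b by rewrite lt_neqAle eq_sym b0 N_ge0.
apply: le_trans (NB_trans Nsemi ((N a)^-1 *: b) _ _) _.
rewrite -scalerBl -scalerBr !NZ// (gtr0_norm (x := (N a)^-1)) ?invr_gt0//.
have -> : `|(N b)^-1 - (N a)^-1| * N b = `|N a - N b| / N a.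
  rewrite -[X in _ * X](gtr0_norm bp) -normrM -[X in _ / X](gtr0_norm ap).
  rewrite -normrV ?unitfE// -normrM; congr `| _ |.
  by rewrite !mulrBl !mulVf// divff// mulrC.
rewrite [_^-1 * _]mulrC mulr_natl mulr2n lerD2r ler_pM2r ?invr_gt0// ler_norml.
have := N_leB Nsemi a b; have := N_leB Nsemi b a; rewrite (NBC Nsemi a b).
by move=> h1 h2; apply/andP; split; lra.
Qed.

Variable E : V -> V -> Prop.
Hypothesis Erefl : forall x, E x x.
Hypothesis Etrans : forall x y z, E x y -> E y z -> E x z.
Hypothesis Eopp : forall x, E x (- x).
Hypothesis Elocal : forall x, N x = 1 -> exists2 d, 0 < d & forall y z,
  N y = 1 -> N z = 1 -> E x y -> N (y - z) < d -> E y z.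

(** The segment avoids 0, and its normalised subdivision points form a chain; one radius [d] serves
    every link because [Elocal] is uniform over the points related to [x]. *)
Lemma sphere_segment x y : N x = 1 -> N y = 1 -> N (x - y) < 2 -> E x y.
Proof.
move=> x1 y1 xy2; have [d d0 Hd] := Elocal x1.
(* On the segment the norm is at least [1 - s N (x - y)] and [1 - (1 - s) N (x - y)], hence at least
   their mean [mu]. *)
pose mu := 1 - N (x - y) / 2; have mu0 : 0 < mu by rewrite /mu; lra.
pose M := (Num.bound (4 / (d * mu))).+1.
have M0 : 0 < M%:R :> R by rewrite ltr0n.
have hM : 4 < M%:R * (d * mu).
  rewrite -ltr_pdivrMr ?mulr_gt0//; apply: (@lt_trans _ _ (Num.bound (4 / (d * mu)))%:R).
    by apply: archi_boundP; rewrite divr_ge0 ?mulr_ge0// ltW.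
  by rewrite ltr_nat.
pose s (i : nat) : R := i%:R / M%:R.
pose p i := x + s i *: (y - x).
have pmu i : (i <= M)%N -> mu <= N (p i).
  move=> iM; have s0 : 0 <= s i by rewrite divr_ge0.
  have s1 : s i <= 1 by rewrite /s ler_pdivrMr// mul1r ler_nat.
  have h1 : N x <= N (p i) + s i * N (x - y).
    apply: le_trans (N_leB Nsemi x (p i)) _.
    by rewrite lerD2l (NBC Nsemi) addrKl NZ// ger0_norm// (NBC Nsemi x).
  have h2 : N y <= N (p i) + (1 - s i) * N (x - y).
    apply: le_trans (N_leB Nsemi y (p i)) _.
    rewrite lerD2l /p opprD addrA -{1}(scale1r (y - x)) -scalerBl NZ//.
    by rewrite ger0_norm ?subr_ge0// (NBC Nsemi x).
  by move: h1 h2; rewrite x1 y1 /mu; nra.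
have pn i : (i <= M)%N -> N (p i) != 0.
  by move=> iM; rewrite gt_eqF//; exact: lt_le_trans (pmu i iM).
pose q i := (N (p i))^-1 *: p i.
have Eq i : (i <= M)%N -> E x (q i).
  elim: i => [_|i IH iM].
    by rewrite /q /p /s mul0r scale0r addr0 x1 invr1 scale1r; exact: Erefl.
  have iM' := ltnW iM; apply: Etrans (IH iM') _.
  apply: Hd; rewrite ?N_normalize ?pn//; first exact: IH.
  rewrite (NBC Nsemi); apply: le_lt_trans (normalize_lipschitz (pn _ iM') (pn _ iM)) _.
  have -> : N (p i.+1 - p i) = N (x - y) / M%:R.
    rewrite /p opprD addrACA subrr add0r -scalerBl NZ// /s -mulrBl -natr1 addrKl.
    by rewrite mul1r gtr0_norm ?invr_gt0// mulrC (NBC Nsemi x).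
  rewrite mulrA ltr_pdivrMr ?(lt_le_trans mu0 (pmu _ _))//.
  apply: (@lt_le_trans _ _ (d * mu)); last by rewrite ler_pM2l// pmu.
  rewrite mulrA ltr_pdivrMr// [_ * M%:R]mulrC; lra.
have := Eq M (leqnn M).
by rewrite /q /p /s divff ?gt_eqF// scale1r addrC subrK y1 invr1 scale1r.
Qed.

(** Points at distance 2 are joined through [- y] or, if [x + y] also has norm 2, through the
    midpoint, which is then a unit vector. *)
Lemma sphere_chain x y : N x = 1 -> N y = 1 -> E x y.
Proof.
move=> x1 y1; have [xy|xy] := ltP (N (x - y)) 2; first exact: sphere_segment.
have [yx|yx] := ltP (N (x + y)) 2.
  apply: (@Etrans _ (- y)); last by rewrite -{2}(opprK y).
  by apply: sphere_segment => //; rewrite ?NN ?opprK.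
have xy' : N (x + y) = 2.
  by apply/eqP; rewrite eq_le yx andbT; have := ND Nsemi x y; lra.
pose m := (1 / 2 : R) *: (x + y).
have m1 : N m = 1 by rewrite NZ// xy' ger0_norm; lra.
have dist u v : N (u - v) <= 2 -> N (u - (1 / 2 : R) *: (u + v)) < 2.
  have -> : u - (1 / 2 : R) *: (u + v) = (1 / 2 : R) *: (u - v).
    rewrite scalerDr scalerBr opprD addrA; congr (_ - _).
    by rewrite -{1}(scale1r u) -scalerBl; congr (_ *: _); field.
  by move=> uv; rewrite NZ// ger0_norm; lra.
have xyle : N (x - y) <= 2 by have := ND Nsemi x (- y); rewrite NN//; lra.
apply: (@Etrans _ m); apply: sphere_segment => //; first exact: dist.
by rewrite (NBC Nsemi) /m (addrC x); apply: dist; rewrite (NBC Nsemi).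
Qed.
End SphereChain.

Section Operators.
Variables (R : realType) (k : scalar_kind) (X : normedModType (scalars R k)).
Local Notation K := (scalars R k).
Local Notation ofr := (@of_real R k).

Section LinearOps.
Variable T : X -> X.
Hypothesis hT : is_linear_op T.
Lemma opD x y : T (x + y) = T x + T y.
Proof. by have := hT 1 x y; rewrite !scale1r. Qed.
Lemma op0 : T 0 = 0.
Proof. by apply: (@addIr _ (T 0)); rewrite -opD !add0r. Qed.
Lemma opZ a x : T (a *: x) = a *: T x.
Proof. by rewrite -[in LHS](addr0 (a *: x)) hT op0 addr0. Qed.
Lemma opB x y : T (x - y) = T x - T y.
Proof. by rewrite opD -scaleN1r opZ scaleN1r. Qed.
End LinearOps.

Section LinearFunctionals.
Variable f : X -> K.
Hypothesis hf : is_linear_functional f.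
Lemma lfD x y : f (x + y) = f x + f y.
Proof. by have := hf 1 x y; rewrite scale1r mul1r. Qed.
Lemma lf0 : f 0 = 0.
Proof. by apply: (@addIr _ (f 0)); rewrite -lfD !add0r. Qed.
Lemma lfZ a x : f (a *: x) = a * f x.
Proof. by rewrite -[in LHS](addr0 (a *: x)) hf lf0 addr0. Qed.
Lemma lfB x y : f (x - y) = f x - f y.
Proof. by rewrite lfD -scaleN1r lfZ mulN1r. Qed.
End LinearFunctionals.

Lemma nrm_unitize (x : X) : nrm x != 0 -> nrm (ofr (nrm x)^-1 *: x) = 1.
Proof.
by move=> x0; rewrite nrmZ sabs_of_real ger0_norm ?invr_ge0 ?nrm_ge0// mulVf.
Qed.

Lemma op_norm_ub (A : X -> X) z :
  bounded_operator A -> nrm (A z) <= op_norm A * nrm z.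
Proof.
move=> [lA [M hM]]; have [z0|z0] := eqVneq (nrm z) 0.
  by rewrite z0 mulr0 (nrm_eq0 z0) (op0 lA) nrm0.
have zp : 0 < nrm z by rewrite lt_neqAle eq_sym z0 nrm_ge0.
rewrite -ler_pdivrMr//.
have -> : nrm (A z) / nrm z = nrm (A (ofr (nrm z)^-1 *: z)).
  by rewrite (opZ lA) nrmZ sabs_of_real gtr0_norm ?invr_gt0// mulrC.
apply: sup_upper_bound; last by exists (ofr (nrm z)^-1 *: z) => //; exact: nrm_unitize.
split; first by eexists; exists (ofr (nrm z)^-1 *: z); [exact: nrm_unitize|].
by exists M => _ [x x1 <-]; rewrite (le_trans (hM x))// x1 mulr1.
Qed.

Lemma op_norm_le (A : X -> X) (B : R) (x : X) : nrm x = 1 ->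
  (forall z, nrm (A z) <= B * nrm z) -> op_norm A <= B.
Proof.
move=> x1 hB; apply: ge_sup; first by exists (nrm (A x)), x.
by move=> _ [z z1 <-]; rewrite (le_trans (hB z))// z1 mulr1.
Qed.

Lemma surj_isometry_opp : surj_isometry (fun x : X => - x).
Proof.
split=> [a x y|]; first by rewrite opprD scalerN.
by split=> [x|y]; [exact: nrmN|exists (- y); rewrite opprK].
Qed.

Lemma surj_isometry_comp (g h : X -> X) :
  surj_isometry g -> surj_isometry h -> surj_isometry (fun x => g (h x)).
Proof.
move=> [gl [gN gs]] [hl [hN hs]]; split=> [a x y|]; first by rewrite hl gl.
split=> [x|y]; first by rewrite gN hN.
by have [u gu] := gs y; have [v hv] := hs u; exists v; rewrite hv.
Qed.

Lemma surj_isometry_inv (g : X -> X) : surj_isometry g ->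
  exists h, [/\ surj_isometry h, cancel g h & cancel h g].
Proof.
move=> [gl [gN gs]]; have [h hK] := choice gs.
have gI : injective g.
  move=> x y gxy; apply/eqP; rewrite -subr_eq0; apply/eqP/nrm_eq0.
  by rewrite -gN (opB gl) gxy subrr nrm0.
have gK : cancel g h by move=> x; apply: gI; rewrite hK.
exists h; split => //; split=> [a x y|].
  by apply: gI; rewrite gl !hK.
by split=> [x|y]; [rewrite -gN hK|exists (g y)].
Qed.

Lemma surj_isometry_bounded (g : X -> X) : surj_isometry g -> bounded_operator g.
Proof. by move=> [gl [gN _]]; split=> //; exists 1 => x; rewrite gN mul1r. Qed.

Lemma bounded_operatorB (S T : X -> X) : bounded_operator S -> bounded_operator T ->
  bounded_operator (fun x => S x - T x).
Proof.
move=> [lS [M hM]] [lT [P hP]]; split=> [a x y|].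
  by rewrite lS lT scalerBr opprD addrACA.
exists (M + P) => x; rewrite mulrDl (le_trans (nrmD _ _))// nrmN.
exact: lerD.
Qed.

Hypothesis micro : micro_transitive X.

Let near_id (e : R) (g : X -> X) := forall z, nrm (g z - z) <= e * nrm z.

Lemma micro_transitive_at (e : R) (x0 : X) : 0 < e -> nrm x0 = 1 ->
  exists2 d : R, 0 < d & forall y, nrm y = 1 -> nrm (y - x0) < d ->
    exists g, [/\ surj_isometry g, g x0 = y & near_id e g].
Proof.
move=> e0 x01.
pose U := [set g : X -> X | surj_isometry g /\ op_norm (fun z => g z - z) < e]%classic.
have [|d d0 Hd] := micro x01 (U := U); first by exists e.
exists d => // y y1 yd; have [g [gi [_ ge] gy]] := Hd y y1 yd.
exists g; split => // z.
apply: le_trans (op_norm_ub (A := fun z => g z - z) z _) _.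
  apply: (@bounded_operatorB g id); first exact: surj_isometry_bounded.
  by split=> [//|]; exists 1 => x; rewrite mul1r.
by rewrite ler_wpM2r ?nrm_ge0// ltW.
Qed.

Let orbit (x y : X) := exists2 g, surj_isometry g & g x = y.

(** Conjugation by an isometry carrying [x0] to [x] preserves the distance to the identity, so the
    radius found at [x0] serves its whole orbit. *)
Lemma micro_transitive_orbit (e : R) (x0 : X) : 0 < e -> nrm x0 = 1 ->
  exists2 d : R, 0 < d & forall x y : X, nrm x = 1 -> nrm y = 1 -> orbit x0 x ->
    nrm (x - y) < d -> exists g, [/\ surj_isometry g, g x = y & near_id e g].
Proof.
move=> e0 x01; have [d d0 Hd] := micro_transitive_at e0 x01.
exists d => // x y x1 y1 [h hi hx] xy.
have [h' [hi' hK hK']] := surj_isometry_inv hi.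
have [||g [gi gx ge]] := Hd (h' y); first by rewrite hi'.2.1.
  by rewrite -(hK x0) hx -(opB hi'.1) hi'.2.1 nrmBC.
exists (fun z => h (g (h' z))); split.
- by apply: surj_isometry_comp hi _; exact: surj_isometry_comp.
- by rewrite -hx hK gx hK'.
- move=> z; rewrite -{2}(hK' z) -(opB hi.1) hi.2.1 -[in leRHS](hi'.2.1 z).
  exact: ge.
Qed.

Lemma isometries_transitive (x y : X) : nrm x = 1 -> nrm y = 1 -> orbit x y.
Proof.
apply: (@sphere_chain R (realified X) _ (nrm_seminorm X) orbit).
- by move=> z; exists id => //; split => //; split=> // u; exists u.
- move=> u v w [g gi gu] [h hi hv]; exists (fun z => h (g z)); last by rewrite gu hv.
  exact: surj_isometry_comp.
- by move=> u; exists (fun z => - z) => //; exact: surj_isometry_opp.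
- move=> u u1; have [d d0 Hd] := micro_transitive_orbit ltr01 u1.
  exists d => // v w v1 w1 ov vw; have [g [gi gv _]] := Hd v w v1 w1 ov vw.
  by exists g.
Qed.

Lemma uniformly_micro_transitive (e : R) : 0 < e ->
  exists2 d : R, 0 < d & forall x y : X, nrm x = 1 -> nrm y = 1 ->
    nrm (x - y) < d -> exists g, [/\ surj_isometry g, g x = y & near_id e g].
Proof.
move=> e0; have [[x0 x01]|none] := pselect (exists x : X, nrm x = 1).
  have [d d0 Hd] := micro_transitive_orbit e0 x01.
  by exists d => // x y x1 y1; apply: Hd => //; exact: isometries_transitive.
by exists 1 => // x y x1; exfalso; apply: none; exists x.
Qed.
End Operators.

(** * States and numerical radius *)

Section States.
Variables (R : realType) (k : scalar_kind) (X : normedModType (scalars R k)).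
Local Notation K := (scalars R k).
Local Notation ofr := (@of_real R k).

(** A pointwise bound replaces the dual norm, whose value 1 is then forced by [f x = 1]. *)
Lemma statesP (x : X) (f : X -> K) : states (x, f) <->
  [/\ nrm x = 1, is_linear_functional f, forall y, sabs (f y) <= nrm y & f x = 1].
Proof.
split=> [[/= x1 [[lf [M hM]] [f1 fx]]]|[x1 lf fN fx]].
  split => // y; have [y0|y0] := eqVneq (nrm y) 0.
    by rewrite y0 (nrm_eq0 y0) (lf0 lf) sabs0.
  have yp : 0 < nrm y by rewrite lt_neqAle eq_sym y0 nrm_ge0.
  rewrite -[leRHS]mul1r -ler_pdivrMr// -f1.
  have -> : sabs (f y) / nrm y = sabs (f (ofr (nrm y)^-1 *: y)).
    by rewrite (lfZ lf) sabsM sabs_of_real gtr0_norm ?invr_gt0// mulrC.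
  apply: sup_upper_bound; last by exists (ofr (nrm y)^-1 *: y) => //; exact: nrm_unitize.
  split; first by exists (sabs (f x)), x.
  by exists M => _ [z z1 <-]; rewrite (le_trans (hM z))// z1 mulr1.
have ub : ubound [set sabs (f y) | y in @unit_sphere R k X]%classic 1.
  by move=> _ [z z1 <-]; rewrite (le_trans (fN z))// z1.
have mem : [set sabs (f y) | y in @unit_sphere R k X]%classic 1.
  by exists x => //; rewrite fx sabs1.
split=> //; split=> /=.
  by split => //; exists 1 => y; rewrite mul1r.
split=> //; apply/eqP; rewrite eq_le ge_sup//=; last by exists 1.
by apply: sup_upper_bound => //; split; exists 1.
Qed.

Lemma state_comp (x : X) f g : states (g x, f) -> surj_isometry g ->
  states (x, fun z => f (g z)).
Proof.
move=> /statesP[x1 lf fN fx] [gl [gN _]]; apply/statesP; split => //.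
- by rewrite -gN.
- by move=> a u v; rewrite gl lf.
- by move=> u; rewrite -gN.
Qed.

Lemma state_phase (x : X) f th : states (x, f) -> sabs th = 1 ->
  states (th *: x, fun z => th^-1 * f z).
Proof.
move=> /statesP[x1 lf fN fx] th1.
have th0 : th != 0 by apply/eqP => t0; move: th1; rewrite t0 sabs0; lra.
have thV : sabs th^-1 = 1.
  by have := sabsM th th^-1; rewrite divff// sabs1 th1 mul1r.
apply/statesP; split.
- by rewrite nrmZ th1 mul1r.
- by move=> a u v; rewrite lf; ring.
- by move=> u; rewrite sabsM thV mul1r.
- by rewrite (lfZ lf) fx mulr1 mulVf.
Qed.

Lemma state_support (x : X) f : states (x, f) ->
  @support R (realified X) (@nrm R k X) (fun z => to_real (f z)) x.
Proof.
move=> /statesP[x1 lf fN fx]; split; last by rewrite fx -(of_real1 R k) of_realK.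
split=> [a u v|u]; last exact: le_trans (to_real_le _) (fN u).
by rewrite -to_realM -to_realD -lf.
Qed.

Section NumericalRadius.
Variables (T : X -> X) (M : R).
Hypothesis hM : forall z, nrm (T z) <= M * nrm z.

Lemma state_op_le (p : X * (X -> K)) : states p -> sabs (p.2 (T p.1)) <= M.
Proof.
case: p => x f /= /statesP[x1 lf fN fx].
by apply: le_trans (fN _) _; have := hM x; rewrite x1 mulr1.
Qed.

Lemma numerical_radius_has_sup (p : X * (X -> K)) : states p ->
  has_sup [set sabs (p.2 (T p.1)) | p in @states R k X]%classic.
Proof.
move=> hp; split; first by exists (sabs (p.2 (T p.1))), p.
by exists M => _ [q hq <-]; exact: state_op_le.
Qed.

Lemma numerical_radius_ge (p : X * (X -> K)) :
  states p -> sabs (p.2 (T p.1)) <= numerical_radius T.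
Proof.
move=> hp; apply: sup_upper_bound; first exact: numerical_radius_has_sup hp.
by exists p.
Qed.

Lemma numerical_radius_adherent (p : X * (X -> K)) (e : R) : states p -> 0 < e ->
  exists2 q, states q & numerical_radius T - e < sabs (q.2 (T q.1)).
Proof.
move=> hp e0; have [_ [q hq <-] he] := sup_adherent e0 (numerical_radius_has_sup hp).
by exists q.
Qed.
End NumericalRadius.

(** The state [p] makes the set under the supremum nonempty. *)
Lemma numerical_radius_le (T : X -> X) (B : R) (p : X * (X -> K)) : states p ->
  (forall q, states q -> sabs (q.2 (T q.1)) <= B) -> numerical_radius T <= B.
Proof.
move=> hp hB; apply: ge_sup; first by exists (sabs (p.2 (T p.1))), p.
by move=> _ [q hq <-]; exact: hB.
Qed.

Lemma numerical_radius_addZ (T G : X -> X) : bounded_operator T -> Zset G ->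
  numerical_radius (fun x => T x + G x) = numerical_radius T.
Proof.
move=> [lT [M hM]] [[lG [P hP]] vG]; rewrite /numerical_radius; congr sup.
apply: eq_imagel => -[x f] hp /=.
have := numerical_radius_ge hP hp; rewrite vG /= => fG.
have /sabs_eq0 fG0 : sabs (f (G x)) = 0 by apply/eqP; rewrite eq_le fG sabs_ge0.
by have /statesP[_ lf _ _] := hp; rewrite (lfD lf) fG0 addr0.
Qed.

(** * Consequences of micro-transitivity for states *)

Hypothesis micro : micro_transitive X.

Lemma realified_umt (e : R) : 0 < e -> exists2 d, 0 < d &
  forall x y : realified X, nrm x = 1 -> nrm y = 1 -> nrm (x - y) < d ->
  exists g, [/\ @lin_isometry R (realified X) (@nrm R k X) g, g x = y &
                forall z, nrm (g z - z) <= e * nrm z].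
Proof.
move=> e0; have [d d0 Hd] := uniformly_micro_transitive micro e0.
exists d => // x y x1 y1 xy; have [g [[gl [gN _]] gx gz]] := Hd x y x1 y1 xy.
by exists g; split => //; split => // a u v; rewrite !realifiedZ gl.
Qed.

Lemma realified_transitive (x y : realified X) : nrm x = 1 -> nrm y = 1 ->
  exists2 g, @lin_isometry R (realified X) (@nrm R k X) g & g x = y.
Proof.
move=> x1 y1; have [g [gl [gN _]] gx] := isometries_transitive micro x1 y1.
by exists g => //; split => // a u v; rewrite !realifiedZ gl.
Qed.

Lemma state_unique (x : X) f h : states (x, f) -> states (x, h) -> f = h.
Proof.
move=> hf hh; apply/funext => z.
have /statesP[x1 lf _ _] := hf; have /statesP[_ lh _ _] := hh.
have E := support_unique (nrm_seminorm X) realified_umt x1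
  (state_support hf) (state_support hh).
(* The real parts agree by [support_unique]; the phase makes [f z - h z] real. *)
have [th th1 thE] := phaseP (f z - h z).
apply/eqP; rewrite -subr_eq0; apply/eqP/sabs_eq0.
rewrite -[LHS](of_realK k) -thE mulrBr -(lfZ lf) -(lfZ lh).
have -> : f (th *: z) - h (th *: z) = f (th *: z) + ofr (-1) * h (th *: z).
  by rewrite (_ : ofr (-1) = -1) ?mulN1r//; case: (k) => //=; rewrite rmorphN1.
by rewrite to_realD to_realM (congr1 (fun F => F (th *: z)) E) mulN1r subrr.
Qed.

Lemma state_uniformly_convex (p : X * (X -> K)) (e : R) : states p -> 0 < e ->
  exists2 d, 0 < d & forall (x : X) f (y : X), states (x, f) -> nrm y = 1 ->
    1 - d <= sabs (f y) -> exists2 th, sabs th = 1 & nrm (x - th *: y) < e.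
Proof.
case: p => x0 f0 hp e0; have /statesP[x01 _ _ _] := hp.
(* Support functionals arise by transporting [f0] along isometries. *)
have supp (x : realified X) : nrm x = 1 ->
    exists F, @support R (realified X) (@nrm R k X) F x.
  move=> x1; have [g gi gx] := isometries_transitive micro x1 x01.
  by eexists; apply: state_support; apply: state_comp gi; rewrite gx; exact: hp.
have [d d0 Hd] := uniformly_convex (nrm_seminorm X) realified_umt
  realified_transitive supp e0.
exists d => // x f y hf y1 fy; have [th th1 thE] := phaseP (f y).
have /statesP[x1 lf _ _] := hf.
exists th => //; apply: (Hd x _ (th *: y) x1 (state_support hf)).
  by rewrite nrmZ th1 y1 mulr1.
by rewrite (lfZ lf) thE of_realK.
Qed.

(** [eta] is fixed before [eta']: at a cost [e] set in advance, the defect at the same state becomes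
    as small as desired, which makes the step iterable. *)
Lemma improve_attainment (p : X * (X -> K)) (M e : R) : states p -> 0 < M -> 0 < e ->
  exists2 eta, 0 < eta & forall eta', 0 < eta' ->
  forall (T : X -> X) x f,
    is_linear_op T -> (forall z, nrm (T z) <= M * nrm z) -> numerical_radius T = 1 ->
    states (x, f) -> 1 - eta < sabs (f (T x)) ->
    exists T' : X -> X, [/\ is_linear_op T', forall z, nrm (T' z - T z) <= e * nrm z,
                   numerical_radius T' = 1 & 1 - eta' < sabs (f (T' x))].
Proof.
(* [A] bounds all modified operators; perturbation, conjugation and renormalisation will each cost
   at most [e / 4]. *)
move=> hp M0 e0; pose A := M + 1; have A0 : 0 < A by rewrite /A; lra.
pose e1 := Num.min (e / (4 * A)) 1.
have eA : 0 < e / (4 * A) by rewrite divr_gt0// mulr_gt0.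
have e10 : 0 < e1 by rewrite lt_min eA ltr01.
have e1A : e1 * A <= e / 4.
  have -> : e / 4 = e / (4 * A) * A by field; rewrite gt_eqF.
  by rewrite ler_pM2r// ge_min lexx.
have e11 : e1 <= 1 by rewrite ge_min lexx orbT.
have [d2 d20 Hd2] := uniformly_micro_transitive micro (e := e / (8 * A))
  ltac:(by rewrite divr_gt0// mulr_gt0).
have [d1 d10 Hd1] := state_uniformly_convex hp d20.
pose d := Num.min d1 1.
have d0 : 0 < d by rewrite lt_min d10 ltr01.
have dd1 : d <= d1 by rewrite ge_min lexx.
have dle1 : d <= 1 by rewrite ge_min lexx orbT.
pose eta := e1 * d / 4; have e1d : 0 < e1 * d by rewrite mulr_gt0.
have e1d' : e1 * d <= e1 by rewrite ler_piMr// ltW.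
have eta0 : 0 < eta by rewrite /eta; lra.
exists eta => // eta' eta'0 T x f lT hM vT hf fT.
have /statesP[x1 lf fN fx] := hf.
have [th th1 thE] := phaseP (f (T x)).
have th0 : th != 0 by apply/eqP => t0; move: th1; rewrite t0 sabs0; lra.
have thV : sabs th^-1 = 1.
  by have := sabsM th th^-1; rewrite divff// sabs1 th1 mul1r.
(* The phase aligns the rank-one term with [f (T x)], so the modulus at [(x, f)] grows by exactly
   [e1]. *)
pose T1 z := T z + (ofr e1 * th^-1 * f z) *: x.
have lT1 : is_linear_op T1.
  move=> a u v; rewrite /T1 lT lf scalerDr addrACA; congr (_ + _).
  by rewrite scalerA -scalerDl; congr (_ *: _); ring.
have T1T z : nrm (T1 z - T z) <= e1 * nrm z.
  rewrite /T1 addrKl nrmZ x1 mulr1 !sabsM thV sabs_of_real gtr0_norm// mulr1.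
  by rewrite ler_pM2l.
have bT1 z : nrm (T1 z) <= A * nrm z.
  apply: le_trans (nrm_leB _ (T z)) _; rewrite /A mulrDl mul1r.
  apply: lerD => //; apply: le_trans (T1T z) _.
  by rewrite ler_piMl ?nrm_ge0.
have fT1 : sabs (f (T1 x)) = sabs (f (T x)) + e1.
  rewrite /T1 (lfD lf) (lfZ lf) fx !mulr1.
  rewrite -[LHS]mul1r -th1 -sabsM mulrDr thE mulrCA divff// mulr1 -of_realD sabs_of_real.
  by rewrite ger0_norm// addr_ge0 ?sabs_ge0// ltW.
pose e3 := Num.min eta' eta.
have e30 : 0 < e3 by rewrite lt_min eta'0.
have e3l : e3 <= eta' by rewrite ge_min lexx.
have e3r : e3 <= eta by rewrite ge_min lexx orbT.
have [[y h] hh hy] := numerical_radius_adherent bT1 hf e30.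
have v1 : 1 - eta + e1 < numerical_radius T1.
  by apply: lt_le_trans (numerical_radius_ge bT1 hf); rewrite fT1; lra.
have /statesP[y1 lh hN hyy] := hh.
have v1le : numerical_radius T1 <= 1 + e1.
  apply: numerical_radius_le hf _ => -[a b] hab /=.
  have /statesP[a1 lb bN _] := hab.
  have -> : T1 a = T a + (T1 a - T a) by rewrite addrC subrK.
  rewrite (lfD lb); apply: le_trans (sabsD _ _) _; apply: lerD.
    by rewrite -vT; exact: (numerical_radius_ge hM hab).
  by apply: le_trans (bN _) _; have := T1T a; rewrite a1 mulr1.
(* The rank-one term adds at most [e1 * |f y|] at [(y, h)], but almost attaining the radius of [T1]
   requires more than [e1 - 2 * eta]. *)
have fy : 1 - d1 <= sabs (f y).
  have : sabs (h (T1 y)) <= 1 + e1 * sabs (f y).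
    rewrite /T1 (lfD lh); apply: le_trans (sabsD _ _) _; apply: lerD.
      by rewrite -vT; exact: (numerical_radius_ge hM hh).
    rewrite (lfZ lh) !sabsM thV sabs_of_real gtr0_norm// mulr1 ler_piMr//.
      by rewrite mulr_ge0 ?sabs_ge0// ltW.
    by have := hN x; rewrite x1.
  move: hy => /= hy H; have : e1 * (1 - d) <= e1 * sabs (f y).
    by move: v1 e3r; rewrite /eta; lra.
  by rewrite ler_pM2l//; lra.
have [ph ph1 phx] := Hd1 x f y hf y1 fy.
have py1 : nrm (ph *: y) = 1 by rewrite nrmZ ph1 mul1r.
have [g [gi gx gz]] := Hd2 x (ph *: y) x1 py1 phx.
have [g' [gi' gK gK']] := surj_isometry_inv gi.
(* Conjugation moves the attainment to [(x, f)]: by uniqueness of states, [f] composed with [g'] is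
   [h] up to the phase. *)
pose T2 z := g' (T1 (g z)).
have lT2 : is_linear_op T2 by move=> a u v; rewrite /T2 gi.1 lT1 gi'.1.
have T2T1 z : nrm (T2 z - T1 z) <= e / 4 * nrm z.
  rewrite -[nrm (_ - _)]gi.2.1 (opB gi.1) /T2 gK'.
  apply: le_trans (nrmB_trans (T1 z) _ _) _; rewrite -(opB lT1).
  have -> : e / 4 * nrm z = A * (e / (8 * A) * nrm z) + e / (8 * A) * (A * nrm z).
    by field; rewrite gt_eqF.
  apply: lerD.
    by apply: le_trans (bT1 _) _; rewrite ler_pM2l.
  rewrite nrmBC; apply: le_trans (gz _) _; rewrite ler_pM2l//.
  by rewrite divr_gt0// mulr_gt0.
have bT2 z : nrm (T2 z) <= A * nrm z.
  by rewrite /T2 gi'.2.1; apply: le_trans (bT1 _) _; rewrite gi.2.1.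
have v2le : numerical_radius T2 <= numerical_radius T1.
  apply: numerical_radius_le hf _ => -[a b] hab /=.
  apply: (numerical_radius_ge bT1 (p := (g a, fun z => b (g' z)))).
  by apply: state_comp gi'; rewrite gK.
have fT2 : sabs (f (T2 x)) = sabs (h (T1 y)).
  have s1 : states (ph *: y, fun z => f (g' z)).
    by apply: state_comp gi'; rewrite -gx gK.
  have E := state_unique s1 (state_phase hh ph1).
  rewrite /T2 gx (opZ lT1) (congr1 (fun F => F (ph *: T1 y)) E) (lfZ lh) mulKf//.
  by apply/eqP => t0; move: ph1; rewrite t0 sabs0; lra.
have v2ge := numerical_radius_ge bT2 hf; rewrite /= fT2 in v2ge.
rewrite /= in hy.
pose v := numerical_radius T2.
have v1' : 1 <= v by move: v1 e3r; rewrite /v /eta; lra.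
have vp : 0 < v by lra.
have vle : v <= 1 + e1 by rewrite /v; lra.
have vV : sabs (ofr v^-1) = v^-1 by rewrite sabs_of_real gtr0_norm// invr_gt0.
(* Dividing by [v >= 1] restores numerical radius 1 and keeps the defect at [(x, f)] below
   [eta']. *)
pose T' z := ofr v^-1 *: T2 z.
have T'T2 z : nrm (T' z - T2 z) <= e / 4 * nrm z.
  have -> : T' z - T2 z = ofr (v^-1 - 1) *: T2 z.
    rewrite /T' -{2}(scale1r (T2 z)) -scalerBl -(of_real1 R k); congr (_ *: _).
    by rewrite of_realD; congr (_ + _); case: (k) => //=; rewrite rmorphN.
  rewrite nrmZ sabs_of_real.
  have : `|v^-1 - 1| <= e1.
    have -> : v^-1 - 1 = - ((v - 1) / v) by field; rewrite gt_eqF.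
    rewrite normrN ger0_norm; last by rewrite divr_ge0//; lra.
    rewrite ler_pdivrMr//; apply: (@le_trans _ _ e1); first lra.
    by rewrite ler_peMr// ltW.
  move=> hv; apply: (@le_trans _ _ (e1 * (A * nrm z))).
    by apply: ler_pM => //; exact: nrm_ge0.
  by rewrite mulrA ler_wpM2r ?nrm_ge0.
have vT'le : numerical_radius T' <= v^-1 * v.
  apply: numerical_radius_le hf _ => -[a b] hab /=.
  have /statesP[_ lb _ _] := hab.
  rewrite /T' (lfZ lb) sabsM vV ler_pM2l ?invr_gt0//.
  exact: (numerical_radius_ge bT2 hab).
have T'fx z : sabs (f (T' z)) = v^-1 * sabs (f (T2 z)).
  by rewrite /T' (lfZ lf) sabsM vV.
have bT' z : nrm (T' z) <= A * nrm z.
  rewrite /T' nrmZ vV; apply: le_trans (bT2 z); rewrite ler_piMl ?nrm_ge0//.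
  by rewrite invf_le1.
exists T'; split.
- by move=> a u w; rewrite /T' lT2 scalerDr !scalerA mulrC.
- move=> z; apply: le_trans (nrmB_trans (T2 z) _ _) _.
  have h1 := T'T2 z; have h2 := nrmB_trans (T1 z) (T2 z) (T z).
  have h3 := T2T1 z; have h4 := T1T z.
  have h5 : e1 * nrm z <= e / 4 * nrm z.
    rewrite ler_wpM2r ?nrm_ge0//; apply: le_trans e1A.
    by rewrite ler_peMr ?(ltW e10)// /A; lra.
  by have := nrm_ge0 z; nra.
- apply/eqP; rewrite eq_le; apply/andP; split.
    by move: vT'le; rewrite mulVf// gt_eqF.
  have : v <= v * numerical_radius T'.
    apply: numerical_radius_le hf _ => -[a b] hab /=.
    have /statesP[_ lb _ _] := hab.
    have := numerical_radius_ge bT' hab.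
    by rewrite /= /T' (lfZ lb) sabsM vV mulrC ler_pdivrMr// mulrC.
  by rewrite -{1}(mulr1 v) ler_pM2l.
- rewrite T'fx fT2 mulrC ltr_pdivlMr//.
  have : 0 <= eta' * (v - 1) by rewrite mulr_ge0 ?(ltW eta'0)// subr_ge0.
  by move: v2le; rewrite -/v; lra.
Qed.
End States.

(** * Iteration to exact attainment *)

Section Attainment.
Variables (R : realType) (k : scalar_kind) (X : completeNormedModType (scalars R k)).
Local Notation K := (scalars R k).

Lemma operator_limit (u : nat -> X -> X) (w : nat -> R) :
  (forall n, is_linear_op (u n)) -> (forall n, 0 <= w n) ->
  (forall e, 0 < e -> exists n, w n < e) ->
  (forall n m z, (n <= m)%N -> nrm (u m z - u n z) <= w n * nrm z) ->
  exists S, [/\ is_linear_op S, forall n z, nrm (S z - u n z) <= w n * nrm z &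
    forall e z, 0 < e -> exists n, forall m, (n <= m)%N -> nrm (u m z - S z) <= e].
Proof.
move=> lu w0 wlim uc.
have lim z : exists l, forall e : R, 0 < e ->
    exists n, forall m, (n <= m)%N -> nrm (u m z - l) <= e.
  apply: cauchy_limit => e e0; have z1 : 0 < nrm z + 1 by have := nrm_ge0 z; lra.
  have [n wn] := wlim _ (divr_gt0 e0 z1); exists n => m nm.
  apply: le_trans (uc _ _ _ nm) _; have := nrm_ge0 z; have := w0 n.
  by move: wn; rewrite ltr_pdivlMr//; nra.
have [S HS] := choice lim; exists S; split.
- move=> a x y; apply/eqP; rewrite -subr_eq0; apply/eqP/nrm_eq0/eqP.
  rewrite eq_le nrm_ge0 andbT; apply/ler_addgt0Pr => e e0; rewrite add0r.
  have a1 : 0 < sabs a + 1 by have := sabs_ge0 a; lra.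
  have e3 : 0 < e / 3 by lra.
  have [n1 h1] := HS (a *: x + y) _ e3.
  have [n2 h2] := HS x _ (divr_gt0 e3 a1).
  have [n3 h3] := HS y _ e3.
  pose m := (n1 + (n2 + n3))%N.
  have {}h1 := h1 m (leq_addr _ _).
  have {}h2 := h2 m (leq_trans (leq_addr _ _) (leq_addl _ _)).
  have {}h3 := h3 m (leq_trans (leq_addl _ _) (leq_addl _ _)).
  rewrite lu in h1.
  have -> : S (a *: x + y) - (a *: S x + S y) =
    a *: (u m x - S x) + (u m y - S y) - (a *: u m x + u m y - S (a *: x + y)).
    by rewrite scalerBr addrACA -opprD opprB [RHS]addrC subrKA.
  apply: le_trans (nrmD _ _) _; rewrite nrmN.
  have := nrmD (a *: (u m x - S x)) (u m y - S y); rewrite nrmZ.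
  have : sabs a * nrm (u m x - S x) <= e / 3.
    rewrite ler_pdivlMr// in h2; have := nrm_ge0 (u m x - S x); lra.
  lra.
- move=> n z; apply/ler_addgt0Pr => e e0; have [m hm] := HS z e e0.
  have := hm (n + m)%N (leq_addl _ _); have := uc n (n + m)%N z (leq_addr _ _).
  have := nrmB_trans (u (n + m)%N z) (S z) (u n z).
  by rewrite (nrmBC (S z) (u (n + m)%N z)); lra.
- by move=> e z e0; exact: HS.
Qed.

Hypothesis micro : micro_transitive X.

Lemma attainment (p : X * (X -> K)) (M e : R) : states p -> 0 < M -> 0 < e ->
  exists2 eta, 0 < eta & forall (T : X -> X) x f,
    is_linear_op T -> (forall z, nrm (T z) <= M * nrm z) -> numerical_radius T = 1 ->
    states (x, f) -> 1 - eta < sabs (f (T x)) ->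
    exists S : X -> X, [/\ bounded_operator S, numerical_radius S = 1,
      sabs (f (S x)) = 1 & forall z, nrm (S z - T z) <= e * nrm z].
Proof.
move=> hp M0 e0; pose w (n : nat) : R := e * 2^-1 ^+ n.
have w0 n : 0 < w n by rewrite mulr_gt0// exprn_gt0// invr_gt0.
have wS n : w n.+1 = w n / 2 by rewrite /w exprSr mulrA.
have Me : 0 < M + e by lra.
have [eta heta] :=
  choice (fun n => (exists2P _ _).1 (improve_attainment micro hp Me (w0 n.+1))).
have eta0 n : 0 < eta n by have [] := heta n.
(* At most [eta n], so that stage [n] can be improved, and tending to 0, so that the limit
   attains. *)
pose d n := Num.min (eta n) (n.+1%:R)^-1.
have d0 n : 0 < d n by rewrite lt_min eta0 invr_gt0 ltr0n.
have deta n : d n <= eta n by rewrite ge_min lexx.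
exists (d 0%N) => // T x f lT hM vT hf fT.
(* The bound absorbs the drift so far, as [w n - w n.+1 = w n.+1], and stays below the [M + e] for
   which [eta] was chosen. *)
pose P n (S : X -> X) := [/\ is_linear_op S,
  forall z, nrm (S z) <= (M + (e - w n)) * nrm z, numerical_radius S = 1
  & 1 - d n < sabs (f (S x))].
have next (nS : nat * (X -> X)) : exists S', P nS.1 nS.2 ->
    P nS.1.+1 S' /\ forall z, nrm (S' z - nS.2 z) <= w nS.1.+1 * nrm z.
  (* Where the invariant fails any value will do; this makes [next] total. *)
  case: nS => n S /=; have [hP|nP] := pselect (P n S); last by exists S.
  have [lS bS vS fS] := hP; have [_ H] := heta n.
  have bS' z : nrm (S z) <= (M + e) * nrm z.
    apply: le_trans (bS z) _; rewrite ler_wpM2r ?nrm_ge0//.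
    by have := w0 n; lra.
  have fS' : 1 - eta n < sabs (f (S x)) by have := deta n; lra.
  have [S' [lS' SS' vS' fS1]] := H _ (d0 n.+1) S x f lS bS' vS hf fS'.
  exists S' => _; split=> //; split => // z.
  apply: le_trans (nrm_leB _ (S z)) _; have := SS' z; have := bS z.
  by rewrite wS; lra.
have [F hF] := choice next.
pose u := fix u n := if n is n'.+1 then F (n', u n') else T.
have hu n : P n (u n).
  elim: n => [|n IH]; last by have [] := hF (n, u n) IH.
  by split => // z; rewrite /w expr0 mulr1 subrr addr0.
have ustep n z : nrm (u n.+1 z - u n z) <= w n.+1 * nrm z.
  by have [_] := hF (n, u n) (hu n); apply.
have udist n m z : (n <= m)%N -> nrm (u m z - u n z) <= (w n - w m) * nrm z.
  move=> /subnK <-; elim: (m - n)%N => [|i IH].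
    by rewrite add0n !subrr nrm0 mul0r.
  apply: le_trans (nrmB_trans (u (i + n)%N z) _ _) _; rewrite addSn.
  by have := ustep (i + n)%N z; move: IH; rewrite wS; lra.
have [||||S [lS SB Slim]] := @operator_limit u w.
- by move=> n; have [] := hu n.
- by move=> n; exact: ltW.
- move=> c c0; have [n hn] := @expr_lt_eventually R 2^-1 (c / e)
    ltac:(by apply/andP; split; lra) (divr_gt0 c0 e0).
  by exists n; rewrite /w mulrC -ltr_pdivlMr.
- move=> n m z nm; apply: le_trans (udist n m z nm) _.
  by rewrite ler_wpM2r ?nrm_ge0//; have := w0 m; lra.
have SM z : nrm (S z) <= (M + e) * nrm z.
  apply: le_trans (nrm_leB _ (T z)) _.
  by have := SB 0%N z; have := hM z; rewrite /= /w expr0 mulr1; lra.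
have /statesP[x1 lf fN _] := hf.
have vS : numerical_radius S <= 1.
  apply: numerical_radius_le hf _ => -[a b] hab /=.
  have /statesP[_ lb bN _] := hab.
  apply/ler_addgt0Pr => c c0; have [n Hn] := Slim c a c0; have := Hn n (leqnn n).
  have [_ bu vu _] := hu n; have := numerical_radius_ge bu hab; rewrite vu /=.
  have := sabsD (b (u n a)) (b (S a - u n a)); rewrite -(lfD lb) addrC subrK.
  by have := bN (S a - u n a); rewrite (nrmBC (S a)); lra.
have fS1 : 1 <= sabs (f (S x)).
  apply/ler_addgt0Pr => c c0; have c2 : 0 < c / 2 by lra.
  have [n Hn] := Slim _ x c2.
  pose m := (n + Num.bound (c / 2)^-1)%N.
  have mc : d m <= c / 2.
    apply: (@le_trans _ _ (m.+1%:R)^-1); first by rewrite ge_min lexx orbT.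
    rewrite -[leRHS]invrK lef_pV2 ?posrE ?invr_gt0// ?ltr0n//.
    apply: ltW; apply: lt_le_trans (archi_boundP _) _; first by rewrite invr_ge0 ltW.
    by rewrite ler_nat leqW// leq_addl.
  have := Hn m (leq_addr _ _); have [_ _ _ fu] := hu m.
  have := sabsD (f (S x)) (f (u m x - S x)); rewrite -(lfD lf) addrC subrK.
  by have := fN (u m x - S x); lra.
have fS2 := numerical_radius_ge SM hf; rewrite /= in fS2.
exists S; split.
- by split=> //; exists (M + e).
- by apply/eqP; rewrite eq_le vS (le_trans fS1).
- by apply/eqP; rewrite eq_le fS1 andbT (le_trans fS2).
- by move=> z; have := SB 0%N z; rewrite /= /w expr0 mulr1.
Qed.

(** At numerical radius 1 the quotient norm is at most [c^-1] for a positive [c] not above the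
    index; a near-minimiser [G] costs at most 1 more. *)
Lemma second_index_bound : (0 < second_numerical_index X)%E ->
  exists2 M : R, 0 < M &
  forall T : X -> X, bounded_operator T -> numerical_radius T = 1 ->
    exists2 G, Zset G & forall z, nrm (T z - G z) <= M * nrm z.
Proof.
move=> idx.
have [c c0 Hc] : exists2 c : R, 0 < c & forall T : X -> X, bounded_operator T ->
    ~ Zset T -> c <= numerical_radius T / quot_norm T.
  have lb (T : X -> X) : bounded_operator T -> ~ Zset T ->
      (second_numerical_index X <= (numerical_radius T / quot_norm T)%:E)%E.
    by move=> bT nT; apply: ereal_inf_lbound; exists T.
  case: (second_numerical_index X) idx lb => [r| |] idx lb.
  - by exists r => [|T bT nT]; [rewrite -lte_fin|rewrite -lee_fin; exact: lb].
  (* An infinite index means that no bounded operator lies outside [Zset]. *)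
  - by exists 1 => // T bT nT; have := lb T bT nT.
  - by [].
exists (c^-1 + 1); first by rewrite ltr_wpDl// invr_ge0 ltW.
move=> T bT vT.
have nT : ~ Zset T by move=> [_]; rewrite vT => /eqP; rewrite oner_eq0.
have := Hc T bT nT; rewrite vT div1r => qc.
have q0 : 0 < quot_norm T by rewrite -invr_gt0; exact: lt_le_trans qc.
have qle : quot_norm T <= c^-1 by rewrite -[leLHS]invrK lef_pV2 ?posrE ?invr_gt0.
(* Otherwise [inf] would take its default value 0, against [q0]. *)
have hi : has_inf [set op_norm (fun x => T x - G x) | G in @Zset R k X]%classic.
  by apply: contrapT => /inf_out h; move: q0; rewrite /quot_norm h ltxx.
have [_ [G hG <-] Gq] := inf_adherent (ltr01 : 0 < 1 :> R) hi.
exists G => // z; apply: le_trans (op_norm_ub (A := fun x => T x - G x) z _) _.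
  by apply: bounded_operatorB => //; case: hG.
rewrite ler_wpM2r ?nrm_ge0// ltW//; apply: lt_le_trans Gq _.
by rewrite lerD2r.
Qed.

End Attainment.

Theorem theorem2p1 (R : realType) (k : scalar_kind)
    (X : completeNormedModType (scalars R k)) :
  micro_transitive X -> (0 < second_numerical_index X)%E -> BPBpp_nu X.
Proof.
move=> micro idx e e0; have [M M0 HM] := second_index_bound idx.
have [[p0 hp0]|none] := pselect (exists p, @states R k X p); last first.
  by exists 1 => // T _ _ p hp; exfalso; apply: none; exists p.
have e2 : 0 < e / 2 by lra.
have [eta eta0 Heta] := attainment micro hp0 M0 e2.
exists eta => // T bT vT [x f] hp /= fT.
(* Subtracting [G] bounds the operator by [M] without changing any value on states; [G] is added
   back at the end. *)
have [G hG TG] := HM T bT vT; have [bG vG] := hG.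
pose T0 z := T z - G z.
have bT0 : bounded_operator T0 by exact: bounded_operatorB.
have TE : T = (fun z => T0 z + G z) by apply/funext => z; rewrite /T0 subrK.
have vT0 : numerical_radius T0 = 1 by rewrite -(numerical_radius_addZ bT0 hG) -TE.
have [bGl [P hP]] := bG.
have fG : f (G x) = 0.
  apply/sabs_eq0/eqP; rewrite eq_le sabs_ge0 andbT.
  by have := numerical_radius_ge hP hp; rewrite vG.
have /statesP[x1 lf _ _] := hp.
have fT0 : 1 - eta < sabs (f (T0 x)) by rewrite /T0 (lfB lf) fG subr0.
have [S0 [bS0 vS0 fS0 S0T]] := Heta T0 x f bT0.1 TG vT0 hp fT0.
have [lS0 [Q hQ]] := bS0.
exists (fun z => S0 z + G z); split.
- split=> [a u v|]; first by rewrite lS0 bGl scalerDr addrACA.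
  exists (Q + P) => z; rewrite mulrDl; apply: le_trans (nrmD _ _) _; exact: lerD.
- by rewrite numerical_radius_addZ.
- by rewrite (lfD lf) fG addr0.
- apply: (@le_lt_trans _ _ (e / 2)); last lra.
  apply: op_norm_le x1 _ => z; have := S0T z; rewrite /T0.
  by rewrite opprB addrA.
Qed.
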